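(* Let $s_N(\boldsymbol\sigma)=\dfrac{S_N(\boldsymbol\sigma)-\frac12 N\log N}{N}$ be the rescaled entropy, and let $\langle\cdot\rangle_{\rm B}$ and $\langle\cdot\rangle_{\rm E}$ denote the expectations when $\boldsymbol\sigma$ is uniformly distributed on the set $\mathcal B_N$ of Dyck bridges of size $N$, respectively on the set $\mathcal C_N$ of Dyck paths of size $N$. Then, as $N\to\infty$, $$\langle s_N\rangle_{\rm B}=-\frac{\gamma_E+2}{2}+\mathcal O\!\left(\frac{\log N}{\sqrt N}\right),\qquad \langle s_N^2\rangle_{\rm B}=\frac43+\frac{\gamma_E^2}{4}+\gamma_E-\frac{\pi^2}{72}+\mathcal O\!\left(\frac{(\log N)^2}{\sqrt N}\right),$$ $$\langle s_N\rangle_{\rm E}=-\frac{\gamma_E}{2}+\mathcal O\!\left(\frac{\log N}{\sqrt N}\right),\qquad \langle s_N^2\rangle_{\rm E}=\frac{\gamma_E^2}{4}+\frac{5\pi^2}{24}-2+\mathcal O\!\left(\frac{(\log N)^2}{\sqrt N}\right).$$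
   Context: $\gamma_E$ is the Euler–Mascheroni constant. $\mathcal B_N$ is the set of $\boldsymbol\sigma=(\sigma_1,\dots,\sigma_{2N})\in\{-1,+1\}^{2N}$ with $\sum_{i=1}^{2N}\sigma_i=0$ (Dyck bridges of size $N$); $\mathcal C_N\subset\mathcal B_N$ is the subset of those $\boldsymbol\sigma$ with all partial sums $\sigma_1+\dots+\sigma_j\ge0$ (Dyck paths, or excursions, of size $N$). For $\boldsymbol\sigma\in\mathcal B_N$ put $h_i(\boldsymbol\sigma)=\sigma_1+\dots+\sigma_{i-1}+\frac{\sigma_i}2$ and $\bar h_i(\boldsymbol\sigma)=|h_i(\boldsymbol\sigma)|+\frac12$, a positive integer. The entropy is $$S_N(\boldsymbol\sigma)=\log Z(\boldsymbol\sigma)=\frac12\sum_{i=1}^{2N}\log \bar h_i(\boldsymbol\sigma),$$ where $Z(\boldsymbol\sigma)=\prod_{i:\,h_i\sigma_i<0}\bar h_i(\boldsymbol\sigma)=\prod_{i=1}^{2N}\sqrt{\bar h_i(\boldsymbol\sigma)}$ is the number of permutations $\pi\in\mathfrak S_N$ minimizing $\sum_{i=1}^N|w_i-b_{\pi(i)}|$ for any $N$ white points $w_1<\dots<w_N$ and $N$ black points $b_1<\dots<b_N$ on a line, all distinct, such that the $i$-th of the $2N$ points from the left is white if $\sigma_i=+1$ and black if $\sigma_i=-1$. *)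

(* Defs.v *)
From HB Require Import structures.
From mathcomp Require Import all_boot all_order all_algebra.
From mathcomp Require Import all_classical all_reals all_analysis.
From mathcomp Require Import lra.
Import Order.TTheory GRing.Theory Num.Theory.
Import numFieldNormedType.Exports.

Set Implicit Arguments.
Unset Strict Implicit.
Unset Printing Implicit Defensive.

Local Open Scope classical_set_scope.
Local Open Scope ring_scope.

(* A sign sequence sigma in {-1,+1}^(2N), with true standing for +1 and false
   for -1; positions are numbered from 0, so that the i-th entry of the usual
   1-based numbering is at position i - 1. *)
Definition sign_seq (N : nat) := {ffun 'I_(2 * N) -> bool}.

Definition spin (N : nat) (s : sign_seq N) (i : 'I_(2 * N)) : int :=
  if s i then 1 else -1.

Definition dyck_bridges (N : nat) : {set sign_seq N} :=
  [set s | \sum_(i < 2 * N) spin s i == 0].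

Definition dyck_paths (N : nat) : {set sign_seq N} :=
  [set s in dyck_bridges N |
    [forall j : 'I_(2 * N), 0 <= \sum_(i < 2 * N | (i <= j)%N) spin s i]].

Section Entropy.
Variable R : realType.

Definition height (N : nat) (s : sign_seq N) (i : 'I_(2 * N)) : R :=
  (\sum_(j < 2 * N | (j < i)%N) spin s j)%:~R + (spin s i)%:~R / 2.

Definition hbar (N : nat) (s : sign_seq N) (i : 'I_(2 * N)) : R :=
  `|height s i| + 2^-1.

(* Number of optimal matchings of 2N coloured points on a line with
   colour pattern s: reading from left to right, each step towards level 0
   matches one of the hbar currently unmatched points of the other colour. *)
Definition optimal_count (N : nat) (s : sign_seq N) : R :=
  \prod_(i < 2 * N | height s i * (spin s i)%:~R < 0) hbar s i.

Definition entropy (N : nat) (s : sign_seq N) : R := ln (optimal_count s).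

Lemma hbar_gt0 (N : nat) (s : sign_seq N) i : 0 < hbar s i.
Proof. by rewrite /hbar ltr_wpDl// invr_gt0 ltr0n. Qed.

Lemma entropyE (N : nat) (s : sign_seq N) : s \in dyck_bridges N ->
  entropy s = 2^-1 * \sum_(i < 2 * N) ln (hbar s i).
Proof.
rewrite inE => /eqP s0.
pose S k : int := \sum_(j < 2 * N | (j < k)%N) spin s j.
pose f (m : int) : R := \sum_(0 <= k < `|m|%N) ln (k.+1%:R).
pose P (i : 'I_(2 * N)) := height s i * (spin s i)%:~R < 0.
have S0 : S 0%N = 0 by rewrite /S big_pred0.
have SN : S (2 * N)%N = 0.
  by rewrite -[RHS]s0; apply: eq_bigl => j; rewrite ltn_ord.
have SS (i : 'I_(2 * N)) : S i.+1 = S i + spin s i.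
  rewrite /S (bigD1 i)//= addrC; congr (_ + _).
  by apply: eq_bigl => j; rewrite ltnS ltn_neqAle andbC.
have tele : \sum_(i < 2 * N) (f (S i.+1) - f (S i)) = 0.
  rewrite -(big_mkord predT (fun i => f (S i.+1) - f (S i))).
  by rewrite telescope_sumr// SN S0 subrr.
have fS n : f n.+1 - f n = ln n.+1%:R.
  by rewrite /f !absz_nat big_nat_recr//= addrAC subrr add0r.
have fN m : f (- m) = f m by rewrite /f abszN.
pose g (x : R) : R := (if x < 0 then -1 else 1) * ln (`|x| + 2^-1).
have up (m : int) : f (m + 1) - f m = g (m%:~R + 2^-1).
  rewrite /g; case: (intP m) => [|n|n].
  - rewrite -[0 + 1]/(1%N%:Z) fS add0r ltNge invr_ge0 ler0n mul1r.
    by rewrite ger0_norm ?invr_ge0// -div1r -splitr.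
  - have h0 : 0 <= n.+1%:R + 2^-1 :> R by rewrite addr_ge0 ?invr_ge0.
    rewrite -PoszD addn1 fS ltNge h0 mul1r ger0_norm// -addrA -div1r -splitr.
    by rewrite -[n.+2]addn1 natrD.
  - have -> : - n.+1%:Z + 1 = - n%:Z by rewrite -addn1 PoszD opprD addrNK.
    have -> : (- n.+1%:Z)%:~R + 2^-1 = - (n%:R + 2^-1) :> R.
      by rewrite rmorphN /= -pmulrn -[n.+1]addn1 natrD; lra.
    have h0 : 0 < n%:R + 2^-1 :> R by rewrite ltr_wpDl ?invr_gt0.
    rewrite !fN oppr_lt0 h0 normrN gtr0_norm// -addrA -div1r -splitr natr1.
    by rewrite mulN1r -fS opprB.
have step (i : 'I_(2 * N)) :
    f (S i.+1) - f (S i) = (if P i then -1 else 1) * ln (hbar s i).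
  rewrite SS /P /hbar /height -/(S i) /spin; case: (s i).
    by rewrite up mulr1 mul1r.
  rewrite -(fN (S i - 1)) -(fN (S i)) opprB [1 - _]addrC up /g.
  have -> : (- S i)%:~R + 2^-1 = - ((S i)%:~R + (-1)%:~R / 2) :> R.
    by rewrite !rmorphN /= mulN1r opprB addrC.
  by rewrite normrN mulrN1.
rewrite /entropy /optimal_count -/P.
have lnprod (Q : pred 'I_(2 * N)) :
    ln (\prod_(i | Q i) hbar s i) = \sum_(i | Q i) ln (hbar s i).
  apply: (@proj2 (0 < \prod_(i | Q i) hbar s i)).
  elim/big_rec2: _ => [|i y x _ [x0 IH]]; first by rewrite ln1.
  by rewrite mulr_gt0 ?hbar_gt0// lnM ?posrE ?hbar_gt0// IH.
rewrite lnprod [in RHS](bigID P)/=; move: tele; rewrite (eq_bigr _ (fun i _ => step i)).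
rewrite (bigID P)/= (eq_bigr (fun i => - ln (hbar s i))); last first.
  by move=> i ->; rewrite mulN1r.
rewrite [X in _ + X](eq_bigr (fun i => ln (hbar s i))); last first.
  by move=> i /negbTE ->; rewrite mul1r.
rewrite sumrN addrC => /eqP; rewrite subr_eq0 => /eqP ->; lra.
Qed.

Definition rescaled_entropy (N : nat) (s : sign_seq N) : R :=
  (entropy s - 2^-1 * N%:R * ln N%:R) / N%:R.

Definition unif_mean (T : finType) (A : {set T}) (f : T -> R) : R :=
  (\sum_(x in A) f x) / #|A|%:R.

Definition euler_gamma : R :=
  lim ((fun n : nat => series harmonic n - ln n%:R) @ \oo).

Lemma cvg_euler_gamma :
  (fun n : nat => series harmonic n - ln n%:R) @ \oo --> euler_gamma.
Proof.
pose u (n : nat) : R := series harmonic n - ln n%:R.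
have n0 (n : nat) : 0 < n.+1%:R :> R by [].
have uS n : u n.+2 <= u n.+1.
  have xE : n.+1%:R / n.+2%:R = 1 + - n.+2%:R^-1 :> R.
    by rewrite -[X in 1 - X]mul1r -[X in X - _](divff (lt0r_neq0 (n0 n.+1)))
      -mulrBl -[n.+2]addn1 natrD addrK.
  have : ln (n.+1%:R / n.+2%:R) <= - n.+2%:R^-1 :> R.
    rewrite xE; apply: le_ln1Dx.
    by rewrite ltrN2 invf_lt1// ltr1n.
  rewrite ln_div ?posrE// /u seriesSr /harmonic /=.
  by move: (series _ _) (ln n.+1%:R) (ln n.+2%:R) (_^-1) => a b c d; lra.
have le n : ln n.+1%:R <= series harmonic n :> R.
  elim: n => [|n IH]; first by rewrite ln1 /series/= big_geq.
  have : ln (1 + n.+1%:R^-1) <= n.+1%:R^-1 :> R.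
    by apply: le_ln1Dx; rewrite (lt_trans (y := 0))// ?ltrN10// invr_gt0.
  have -> : 1 + n.+1%:R^-1 = n.+2%:R / n.+1%:R :> R.
    by rewrite -[X in X + _](divff (lt0r_neq0 (n0 n)))
      -[X in _ + X]mul1r -mulrDl natr1.
  rewrite ln_div ?posrE// seriesSr; move: IH; rewrite /harmonic /=.
  by move: (series _ _) (ln n.+1%:R) (ln n.+2%:R) (_^-1) => a b c d; lra.
suff : cvgn u by [].
suff : cvgn [sequence u n.+1]_n by move/cvg_ex => [l]; rewrite cvg_shiftS => /cvgP.
apply: nonincreasing_is_cvgn.
  by apply/nonincreasing_seqP => n; exact: uS.
exists 0 => _ [n _ <-]; rewrite /u subr_ge0.
by apply: le_trans (le n.+1); rewrite ler_ln ?posrE// ler_nat.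
Qed.

End Entropy.

Arguments euler_gamma {R}.

(* Main.v *)
Require Import Defs.
From HB Require Import structures.
From mathcomp Require Import all_boot all_order all_algebra.
From mathcomp Require Import all_classical all_reals all_analysis.
From mathcomp Require Import ring lra zify.
Import Order.TTheory GRing.Theory Num.Theory.
Import numFieldNormedType.Exports.

Local Open Scope classical_set_scope.
Local Open Scope ring_scope.

Set Implicit Arguments.
Unset Strict Implicit.
Unset Printing Implicit Defensive.

(* By the formula S_N = (1/2) sum_i ln hbar_i, and since
   ln h = H_h - gamma + O(1/h) for the harmonic numbers H_h, the entropy can be
   replaced by T/2 - gamma N, where T = sum_i H_{hbar_i}, at the cost of the sum
   of the 1/hbar_i, whose mean is O(sqrt N log N).

   The first two moments of sum_i a(hbar_i) are computed exactly for an arbitrary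
   a: their total over the n-step walks from level x to level 0 has the form sum_j c_{x,j} w_n(x + 2j), where
   w_n counts walks and the coefficients c_{x,j} do not depend on n.  Taking
   x = 0, the moments become sums of coefficients against
   r_N(m) = binomial(2N, N + m) / binomial(2N, N); for a = H the coefficients are
   polynomials in m, H_m and H_m^(2) = sum_{k <= m} 1/k^2.

   These sums follow from two identities, a summation by parts
   (m r_N(m) is the difference of (N + m) r_N(m) / 2) and the recurrence
   r_{N+1}(m) - r_N(m) = m^2 r_{N+1}(m) / (N + 1)^2.  They give for instance
   sum_m r_N(m) / m = H_N / 2 and
   sum_m H_m r_N(m) / m = (H_N^2 + H_N^(2)) / 8 + (1/2) sum_m r_N(m) / m^2.
   The constants in pi^2 come from H_N^(2) = pi^2 / 6 + O(1/N). *)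

(** * Walks and kernels *)

(** The exact formulas come from generating functions. Let z mark a step, z = u / (1 + u^2) and q =
    u^2. The walks from level x to level 0 have generating function u^x (1 + q) / (1 - q), so
    raising the level by 2 multiplies it by q, and removing one step multiplies it by 1/z = (1 + q)
    / u. Hence if a moment series is that of the walks times a power series in q, then it is a
    combination of walk counts at the levels x + 2j, with coefficients that do not depend on n; the
    variable 'X of the polynomials below is q. Decomposing a walk at its first step becomes a
    recurrence in x alone between these coefficient series, and a denominator 1 - q becomes a sum of
    counts over all higher levels of the same parity. In order to work with polynomials instead of
    power series, the weight a is cut off beyond the reach of an n-step walk, which changes neither
    the moments nor the coefficients that are used. *)

Section Walks.
Variable R : realType.
Implicit Types (f g : {poly R}) (K : nat -> nat -> R).

(* Walks between x and 0 with steps +1 and -1, where x is an absolute value: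
   from level 0 both steps lead to level 1. *)
Fixpoint walks (n x : nat) : nat :=
  match n, x with
  | 0, 0 => 1
  | 0, _.+1 => 0
  | n'.+1, 0 => (walks n' 1).*2
  | n'.+1, x'.+1 => walks n' x' + walks n' x'.+2
  end.

Lemma walks_gt n x : (n < x)%N -> walks n x = 0%N.
Proof.
elim: n x => [|n IH] [|x]//= nx.
by rewrite !IH// ltnW// ltnW.
Qed.

Lemma walks_bin x k : walks (x + k.*2) x = 'C(x + k.*2, k).
Proof.
move e : (x + k.*2)%N => n; elim: n x k e => [|n IH] [|x] [|k] //=.
- rewrite add0n doubleS => -[e]; rewrite (IH 1%N k) -?e// binS -addnn; congr addn.
  by rewrite -[RHS]bin_sub -?e -?addnn ?add1n ?ltnS ?leq_addr// subSS addnK.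
- rewrite addn0 => -[e]; rewrite (IH x 0%N) ?addn0// bin0 walks_gt ?bin0//.
  by rewrite -e ltnS leqnSn.
- rewrite addSn doubleS !addnS => -[e].
  by rewrite (IH x k.+1) ?doubleS ?addnS// (IH x.+2 k) ?addSn// binS.
Qed.

(** Met by the walk counts and by their iterated sums over higher levels. Nothing is asked of
    [K n.+1 0], since those sums break the doubling rule at level 0; this is why [walk_poly] wants
    [G 0] divisible by 'X, which moves the pairing from level 0 to level 2, where the recurrence
    applies. *)
Definition step_kernel K := (forall n x, (n < x)%N -> K n x = 0) /\
  (forall n x, K n.+1 x.+1 = K n x + K n x.+2).

(* 'X^j is paired with the value at x + 2j, so that multiplication by 'X amounts
   to raising the level x by 2: see wpairX. *)
Definition wpair K n x f : R := \sum_(j < n.+1) f`_j * K n (x + j.*2)%N.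

Lemma wpair_widen K n x f m : step_kernel K -> (n < m)%N ->
  wpair K n x f = \sum_(j < m) f`_j * K n (x + j.*2)%N.
Proof.
move=> [K0 _] nm; rewrite /wpair (big_ord_widen _ (fun j => f`_j * K n (x + j.*2)%N) nm).
rewrite big_mkcond/=; apply: eq_bigr => i _; case: ltnP => // ni.
by rewrite K0 ?mulr0// -addnn addnA; rewrite (leq_trans ni)// leq_addl.
Qed.

Lemma wpairD K n x f g : wpair K n x (f + g) = wpair K n x f + wpair K n x g.
Proof. by rewrite -big_split; apply: eq_bigr => i _; rewrite coefD mulrDl. Qed.

Lemma wpairZ K n x c f : wpair K n x (c *: f) = c * wpair K n x f.
Proof. by rewrite mulr_sumr; apply: eq_bigr => i _; rewrite coefZ mulrA. Qed.

Lemma wpairX K n x f : step_kernel K ->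
  wpair K n x ('X * f) = wpair K n x.+2 f.
Proof.
move=> HK; rewrite (@wpair_widen _ n x _ n.+2)//.
rewrite big_ord_recl/= coefXM/= mul0r add0r; apply: eq_bigr => i _.
by rewrite coefXM/= /bump/= add1n doubleS !addnS !addSn.
Qed.

(** A step from x + 1 + 2j leads to x + 2j or to x + 2(j + 1), hence the factor 1 + 'X per unit of
    time. *)
Lemma wpair_step K n x f : step_kernel K ->
  wpair K n.+1 x.+1 f = wpair K n x ((1 + 'X) * f).
Proof.
move=> HK; rewrite mulrDl mul1r wpairD wpairX//.
rewrite !(@wpair_widen _ n _ _ n.+2)//.
rewrite -big_split; apply: eq_bigr => i _.
by rewrite /= -mulrDr addSn (proj2 HK) !addSn.
Qed.

(* M n x stands for a total over the n-step walks from level x to level 0;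
   s1 x and s2 x are the contributions of a first step along the edge between
   x and x.+1, downwards and upwards respectively.  The polynomials G x do not
   depend on n: only the kernel does. *)
Lemma walk_poly K (M : nat -> nat -> R) (G s1 s2 : nat -> {poly R}) (c : R) (G0 : {poly R}) :
  step_kernel K ->
  G 0%N = 'X * G0 ->
  (1 + 'X) * G0 = c *: (G 1%N + s2 0%N) ->
  (forall x, (1 + 'X) * G x.+1 = G x + s1 x + 'X * (G x.+2 + s2 x.+1)) ->
  (forall x, M 0%N x = 0) ->
  (forall n, M n.+1 0%N = c * (M n 1%N + wpair K n 1 (s2 0%N))) ->
  (forall n x, M n.+1 x.+1 = M n x + wpair K n x (s1 x) +
     (M n x.+2 + wpair K n x.+2 (s2 x.+1))) ->
  forall n x, M n x = wpair K n x (G x).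
Proof.
move=> HK G0E bd rec M0 MS0 MSS; elim=> [|n IH] [|x].
- by rewrite M0 /wpair big_ord1 G0E coefXM mul0r.
- by rewrite M0 /wpair big_ord1 (proj1 HK)// mulr0.
- by rewrite MS0 IH G0E wpairX// wpair_step// bd wpairZ wpairD.
- by rewrite MSS !IH wpair_step// rec !wpairD wpairX// !wpairD.
Qed.

End Walks.

(** * Polynomials encoding the moments *)

Section PolynomialSolution.
Variables (R : realType) (a : nat -> R) (L : nat).
Hypothesis aL : forall h, (L < h)%N -> a h = 0.
Hypothesis a0 : a 0%N = 0.

Definition shift_poly x : {poly R} := \poly_(j < L.+1) a (x + j).

Lemma coef_shift_poly x j : (shift_poly x)`_j = a (x + j).
Proof.
rewrite coef_poly; case: ltnP => // Lj; rewrite aL//.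
by rewrite (leq_trans Lj)// leq_addl.
Qed.

Lemma shift_poly_gt x : (L < x)%N -> shift_poly x = 0.
Proof.
move=> Lx; apply/polyP => j; rewrite coef_shift_poly coef0 aL//.
by rewrite (leq_trans Lx)// leq_addr.
Qed.

Lemma shift_polyE x : shift_poly x = (a x)%:P + 'X * shift_poly x.+1.
Proof.
apply/polyP => -[|j]; rewrite coefD coefC coefXM !coef_shift_poly/=.
  by rewrite addn0 addr0.
by rewrite add0r addnS addSn.
Qed.

(** For x > 0, and up to the factor 4 * (1 + 'X), this is the variance contributed by the first
    passage from level x to level x - 1. The sum is morally infinite; L + 1 terms suffice because
    [shift_poly] vanishes beyond L. *)
Definition tail_squares x : {poly R} :=
  \sum_(i < L.+1) 'X^(i.+1) * shift_poly (x + i.+1) ^+ 2.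

Lemma tail_squaresE x :
  tail_squares x = 'X * (shift_poly x.+1 ^+ 2 + tail_squares x.+1).
Proof.
rewrite /tail_squares big_ord_recl/= expr1 addn1 mulrDr; congr (_ + _).
rewrite big_ord_recr/= [X in X ^+ 2]shift_poly_gt; last first.
  by rewrite addnS ltnS leq_addl.
rewrite expr0n mulr0 addr0 mulr_sumr; apply: eq_bigr => i _.
by rewrite mulrA -exprS /bump/= add1n addnS addSn.
Qed.

(* max_poly x is the sum over h, k > 0 of a (x + h) * a (x + k) * 'X^(maxn h k). *)
Definition max_poly x : {poly R} :=
  (1 - 'X) * tail_squares x + 'X ^+ 2 * shift_poly x.+1 ^+ 2.

(** The pairs (h, k) with minimum 1 are split off; the others are shifted down by 1 in both
    entries. *)
Lemma max_polyE x : max_poly x = 'X * (max_poly x.+1 +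
  (a x.+1)%:P * (2 * shift_poly x.+1 - (a x.+1)%:P)).
Proof. by rewrite /max_poly tail_squaresE (shift_polyE x.+1); ring. Qed.

Lemma coef_max_poly0 x : (max_poly x)`_0 = 0.
Proof. by rewrite max_polyE coefXM. Qed.

Lemma coef_max_polyS x j : (max_poly x)`_j.+1 =
  a (x + j.+1) * (2 * (\sum_(i < j.+1) a (x + i.+1)) - a (x + j.+1)).
Proof.
have cC c (p : {poly R}) i : (c%:P * (2 * p - c%:P))`_i =
    c * (2 * p`_i - (i == 0)%N%:R * c).
  rewrite coefCM coefB coefC -(polyC_natr R 2) coefCM; case: i => [|i]; by rewrite /= ?mul1r ?mul0r.
elim: j x => [|j IH] x.
  rewrite max_polyE coefXM/= coefD coef_max_poly0 add0r cC coef_shift_poly.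
  by rewrite big_ord1 !addn0 addn1 mul1r.
rewrite max_polyE coefXM/= coefD IH cC/= coef_shift_poly mul0r subr0.
rewrite [in RHS]big_ord_recl/= !addnS addSn addn0.
under eq_bigr do rewrite addSnnS.
by ring.
Qed.

(* With q = 'X, let b_x and d_x be the generating functions of the first and
   second moments of the sum of the a's over walks from x to 0, divided by that
   of the number of walks.  Then bridge_poly1 is (1 - q) b_x and bridge_poly2 is
   (1 - q)^2 d_x.  The variance d_x - b_x^2 is additive over the successive first
   passages from x to 0, hence the telescopic form of bridge_poly2. *)
Definition bridge_poly1 x : {poly R} := 4 * 'X * shift_poly 1 +
  (1 - 'X) * \sum_(i < x) (2 * shift_poly i.+1 - (a i.+1)%:P).

Definition bridge_poly2 x : {poly R} := bridge_poly1 x ^+ 2 +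
  8 * 'X * (1 + 'X) * ((1 - 'X) * tail_squares 1 + shift_poly 1 ^+ 2) +
  4 * (1 - 'X) ^+ 2 * (1 + 'X) * \sum_(i < x) tail_squares i.+1.

Lemma bridge_poly1S x : bridge_poly1 x.+1 = bridge_poly1 x +
  (1 - 'X) * (2 * shift_poly x.+1 - (a x.+1)%:P).
Proof. by rewrite /bridge_poly1 big_ord_recr/=; ring. Qed.

Lemma bridge_poly2S x : bridge_poly2 x.+1 =
  bridge_poly2 x - bridge_poly1 x ^+ 2 + bridge_poly1 x.+1 ^+ 2 +
  4 * (1 - 'X) ^+ 2 * (1 + 'X) * tail_squares x.+1.
Proof. by rewrite /bridge_poly2 big_ord_recr/=; ring. Qed.

Lemma bridge_poly1_0 : bridge_poly1 0 = 'X * (4 * shift_poly 1).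
Proof. by rewrite /bridge_poly1 big_ord0; ring. Qed.

(** At level 0 the sums of squared tails combine into [max_poly], whose coefficients are explicit in
    the weight. The same happens for excursions in [excursion_poly2_0]. *)
Lemma bridge_poly2_0 : bridge_poly2 0 =
  8 * (1 + 'X) * max_poly 0 + 16 * shift_poly 0 ^+ 2.
Proof.
rewrite /bridge_poly2 bridge_poly1_0 big_ord0 /max_poly (tail_squaresE 0).
by rewrite (shift_polyE 0) a0; ring.
Qed.

Lemma bridge_poly1_rec x : (1 + 'X) * bridge_poly1 x.+1 =
  bridge_poly1 x + (a x.+1)%:P * (1 - 'X) +
  'X * (bridge_poly1 x.+2 + (a x.+2)%:P * (1 - 'X)).
Proof. by rewrite !bridge_poly1S (shift_polyE x.+1); ring. Qed.

Lemma bridge_poly2_rec x : (1 + 'X) * bridge_poly2 x.+1 =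
  bridge_poly2 x + (2 * (a x.+1)%:P * (1 - 'X) * bridge_poly1 x +
     (a x.+1)%:P ^+ 2 * (1 - 'X) ^+ 2) +
  'X * (bridge_poly2 x.+2 + (2 * (a x.+2)%:P * (1 - 'X) * bridge_poly1 x.+2 +
     (a x.+2)%:P ^+ 2 * (1 - 'X) ^+ 2)).
Proof.
by rewrite !bridge_poly2S !bridge_poly1S (tail_squaresE x.+1) (shift_polyE x.+1); ring.
Qed.

Lemma bridge_poly2_bd :
  (1 + 'X) * bridge_poly2 0 = 'X * (2 *
   (bridge_poly2 1 + (2 * (a 1)%:P * (1 - 'X) * bridge_poly1 1 +
      (a 1)%:P ^+ 2 * (1 - 'X) ^+ 2))).
Proof.
rewrite bridge_poly2S bridge_poly1S bridge_poly1_0 bridge_poly2_0 /max_poly.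
by rewrite (tail_squaresE 0) (shift_polyE 0) a0; ring.
Qed.

Lemma bridge_poly1_bd : (1 + 'X) * bridge_poly1 0 =
  'X * (2 * (bridge_poly1 1 + (a 1)%:P * (1 - 'X))).
Proof. by rewrite bridge_poly1S bridge_poly1_0; ring. Qed.

(* For walks that stay nonnegative, b_x and d_x are already polynomials. *)
Definition excursion_poly1 x : {poly R} := 2 * 'X * shift_poly 1 +
  \sum_(i < x) (2 * shift_poly i.+1 - (a i.+1)%:P).

Definition excursion_poly2 x : {poly R} := excursion_poly1 x ^+ 2 +
  4 * (1 + 'X) * \sum_(i < x.+1) tail_squares i.

Lemma excursion_poly1S x : excursion_poly1 x.+1 = excursion_poly1 x +
  (2 * shift_poly x.+1 - (a x.+1)%:P).
Proof. by rewrite /excursion_poly1 big_ord_recr/=; ring. Qed.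

Lemma excursion_poly2S x : excursion_poly2 x.+1 =
  excursion_poly2 x - excursion_poly1 x ^+ 2 + excursion_poly1 x.+1 ^+ 2 +
  4 * (1 + 'X) * tail_squares x.+1.
Proof. by rewrite /excursion_poly2 [in LHS]big_ord_recr/=; ring. Qed.

Lemma excursion_poly1_0 : excursion_poly1 0 = 2 * 'X * shift_poly 1.
Proof. by rewrite /excursion_poly1 big_ord0 addr0. Qed.

Lemma excursion_poly2_0 : (1 - 'X) * excursion_poly2 0 =
  4 * (1 + 'X) * max_poly 0 - 8 * 'X * shift_poly 0 ^+ 2.
Proof.
rewrite /excursion_poly2 excursion_poly1_0 big_ord1/= /max_poly.
by rewrite (shift_polyE 0) a0; ring.
Qed.

Lemma excursion_poly1_rec x : (1 + 'X) * excursion_poly1 x.+1 =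
  excursion_poly1 x + (a x.+1)%:P + 'X * (excursion_poly1 x.+2 + (a x.+2)%:P).
Proof. by rewrite !excursion_poly1S (shift_polyE x.+1); ring. Qed.

Lemma excursion_poly2_rec x : (1 + 'X) * excursion_poly2 x.+1 =
  excursion_poly2 x + (2 * (a x.+1)%:P * excursion_poly1 x + (a x.+1)%:P ^+ 2) +
  'X * (excursion_poly2 x.+2 +
     (2 * (a x.+2)%:P * excursion_poly1 x.+2 + (a x.+2)%:P ^+ 2)).
Proof.
by rewrite !excursion_poly2S !excursion_poly1S (tail_squaresE x.+1) (shift_polyE x.+1); ring.
Qed.

Lemma excursion_poly1_bd : (1 + 'X) * excursion_poly1 0 =
  'X * (excursion_poly1 1 + (a 1)%:P).
Proof. by rewrite excursion_poly1S excursion_poly1_0; ring. Qed.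

Lemma excursion_poly2_bd : (1 + 'X) * excursion_poly2 0 =
  'X * (excursion_poly2 1 + (2 * (a 1)%:P * excursion_poly1 1 + (a 1)%:P ^+ 2)).
Proof.
rewrite excursion_poly2S excursion_poly1S /excursion_poly2 excursion_poly1_0 big_ord1/=.
by rewrite (tail_squaresE 0); ring.
Qed.

End PolynomialSolution.

(** * Sign sequences *)

Section SignSequences.
Variables (R : realType) (a : nat -> R).
Implicit Types (x : int) (phi : R -> R).

Definition sgn_step (b : bool) : int := if b then 1 else -1.

(* Label h of the edge between levels h - 1 and h, or between - h + 1 and - h. *)
Definition edge_level x b : nat := maxn `|x| `|x + sgn_step b|.

Definition position n x (s : {ffun 'I_n -> bool}) (i : nat) : int :=
  x + \sum_(j < n | (j < i)%N) sgn_step (s j).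

Definition walk_sum n x (s : {ffun 'I_n -> bool}) : R :=
  \sum_(i < n) a (edge_level (position x s i) (s i)).

Definition ends_at0 n x (s : {ffun 'I_n -> bool}) : bool :=
  x + \sum_(i < n) sgn_step (s i) == 0.

Definition stays_ge0 n x (s : {ffun 'I_n -> bool}) : bool :=
  [forall j : 'I_n, 0 <= x + \sum_(i < n | (i <= j)%N) sgn_step (s i)].

Definition ffun_cons n (b : bool) (s : {ffun 'I_n -> bool}) : {ffun 'I_n.+1 -> bool} :=
  [ffun i => oapp s b (unlift ord0 i)].

Lemma ffun_cons0 n b (s : {ffun 'I_n -> bool}) : ffun_cons b s ord0 = b.
Proof. by rewrite ffunE unlift_none. Qed.

Lemma ffun_consS n b (s : {ffun 'I_n -> bool}) i :
  ffun_cons b s (lift ord0 i) = s i.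
Proof. by rewrite ffunE liftK. Qed.

Lemma sum_ffunS n (P : pred {ffun 'I_n.+1 -> bool}) (F : {ffun 'I_n.+1 -> bool} -> R) :
  \sum_(s | P s) F s =
  \sum_(b : bool) \sum_(s : {ffun 'I_n -> bool} | P (ffun_cons b s)) F (ffun_cons b s).
Proof.
rewrite pair_big_dep/=.
rewrite (reindex (fun p : bool * {ffun 'I_n -> bool} => ffun_cons p.1 p.2))//.
exists (fun s : {ffun 'I_n.+1 -> bool} => (s ord0, [ffun i : 'I_n => s (lift ord0 i)])) => [[b s] _|s _] /=.
  rewrite ffun_cons0; congr pair; apply/ffunP => i.
  by rewrite ffunE ffun_consS.
apply/ffunP => i; rewrite ffunE; case: unliftP => [j ->|->] /=; by rewrite ?ffunE.
Qed.

Lemma position0 n x (s : {ffun 'I_n -> bool}) : position x s 0 = x.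
Proof. by rewrite /position big_pred0// addr0. Qed.

Lemma position_cons n x b (s : {ffun 'I_n -> bool}) i :
  position x (ffun_cons b s) i.+1 = position (x + sgn_step b) s i.
Proof.
rewrite /position big_mkcond/= big_ord_recl/= ffun_cons0 addrA; congr (_ + _).
by rewrite [RHS]big_mkcond; apply: eq_bigr => j _; rewrite ffun_consS.
Qed.

Lemma walk_sum_cons n x b (s : {ffun 'I_n -> bool}) :
  walk_sum x (ffun_cons b s) = a (edge_level x b) + walk_sum (x + sgn_step b) s.
Proof.
rewrite /walk_sum big_ord_recl/= position0 ffun_cons0; congr (_ + _).
by apply: eq_bigr => i _; rewrite position_cons ffun_consS.
Qed.

Lemma ends_at0_cons n x b (s : {ffun 'I_n -> bool}) :
  ends_at0 x (ffun_cons b s) = ends_at0 (x + sgn_step b) s.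
Proof.
rewrite /ends_at0 big_ord_recl ffun_cons0 addrA.
by under eq_bigr do rewrite ffun_consS.
Qed.

Lemma stays_ge0_cons n x b (s : {ffun 'I_n -> bool}) :
  stays_ge0 x (ffun_cons b s) =
  (0 <= x + sgn_step b) && stays_ge0 (x + sgn_step b) s.
Proof.
have E j : x + \sum_(i < n.+1 | (i <= j)%N) sgn_step (ffun_cons b s i) =
    position x (ffun_cons b s) j.+1 by [].
apply/forallP/andP => [H|[H1 /forallP H2] j].
  split; first by move: (H ord0); rewrite E position_cons position0.
  apply/forallP => j; move: (H (lift ord0 j)).
  by rewrite E /= position_cons.
rewrite E position_cons; case: (unliftP ord0 j) => [k ->|->] /=.
  exact: H2.
by rewrite position0.
Qed.

(** An arbitrary [phi] is needed because removing the first step shifts its argument by the weight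
    of that step. The choices 1, t and t^2 give the number of walks and the two moments. *)
Definition bridge_total phi n x : R :=
  \sum_(s : {ffun 'I_n -> bool} | ends_at0 x s) phi (walk_sum x s).

Definition excursion_total phi n x : R :=
  \sum_(s : {ffun 'I_n -> bool} | ends_at0 x s && stays_ge0 x s)
     phi (walk_sum x s).

Lemma bridge_totalS phi n x : bridge_total phi n.+1 x =
  \sum_b bridge_total (fun t => phi (a (edge_level x b) + t)) n (x + sgn_step b).
Proof.
rewrite /bridge_total sum_ffunS; apply: eq_bigr => b _.
by apply: eq_big => [s|s _]; rewrite ?ends_at0_cons ?walk_sum_cons.
Qed.

Lemma excursion_totalS phi n x : excursion_total phi n.+1 x =
  \sum_(b | 0 <= x + sgn_step b)
    excursion_total (fun t => phi (a (edge_level x b) + t)) n (x + sgn_step b).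
Proof.
rewrite /excursion_total sum_ffunS [RHS]big_mkcond; apply: eq_bigr => b _.
case: ifPn => [xb|/negbTE xb].
  by apply: eq_big => [s|s _]; rewrite ?ends_at0_cons ?stays_ge0_cons ?xb ?walk_sum_cons.
by rewrite big_pred0// => s; rewrite stays_ge0_cons xb andbF.
Qed.

Lemma edge_levelN x b : edge_level (- x) b = edge_level x (~~ b).
Proof.
rewrite /edge_level abszN; congr maxn; rewrite -abszN opprD opprK.
by case: b; rewrite /sgn_step /= ?opprK.
Qed.

(** Reflection in level 0. It allows starting levels to be natural numbers and is the source of the
    factor 2 at level 0. *)
Lemma bridge_totalN phi n x : bridge_total phi n (- x) = bridge_total phi n x.
Proof.
elim: n phi x => [|n IH] phi x.
  rewrite /bridge_total; apply: eq_big => [s|s _].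
    by rewrite /ends_at0 !big_ord0 !addr0 oppr_eq0.
  by rewrite /walk_sum !big_ord0.
rewrite !bridge_totalS (reindex_inj negb_inj)/=; apply: eq_bigr => b _.
rewrite edge_levelN negbK -IH; congr bridge_total.
by rewrite opprD opprK; case: b; rewrite /sgn_step /= ?opprK.
Qed.

Lemma edge_level_up (x : nat) : edge_level x%:Z true = x.+1.
Proof. by rewrite /edge_level /sgn_step -PoszD addn1 !absz_nat (maxn_idPr _). Qed.

Lemma edge_level_down (x : nat) : edge_level x.+1%:Z false = x.+1.
Proof.
rewrite /edge_level /sgn_step -[x.+1]addn1 PoszD addrK -PoszD addn1 !absz_nat.
by rewrite (maxn_idPl _).
Qed.

Lemma Posz_up (x : nat) : x%:Z + sgn_step true = x.+1%:Z.
Proof. by rewrite /sgn_step -PoszD addn1. Qed.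

Lemma Posz_down (x : nat) : x.+1%:Z + sgn_step false = x%:Z.
Proof. by rewrite /sgn_step -[x.+1]addn1 PoszD addrK. Qed.

Lemma bridge_total_nat0 phi n : bridge_total phi n.+1 0 =
  2 * bridge_total (fun t => phi (a 1 + t)) n 1.
Proof.
rewrite bridge_totalS big_bool/= (edge_level_up 0) (Posz_up 0).
rewrite -[X in edge_level X false]oppr0 edge_levelN (edge_level_up 0).
rewrite -[X in _ + X]bridge_totalN opprD oppr0.
by rewrite mulr2n mulrDl mul1r.
Qed.

Lemma bridge_total_natS phi n (x : nat) : bridge_total phi n.+1 x.+1%:Z =
  bridge_total (fun t => phi (a x.+1 + t)) n x%:Z +
  bridge_total (fun t => phi (a x.+2 + t)) n x.+2%:Z.
Proof.
by rewrite bridge_totalS big_bool/= edge_level_up edge_level_down Posz_up Posz_down addrC.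
Qed.

Lemma excursion_total_nat0 phi n : excursion_total phi n.+1 0 =
  excursion_total (fun t => phi (a 1 + t)) n 1.
Proof.
by rewrite excursion_totalS big_mkcond big_bool/= (edge_level_up 0) (Posz_up 0) addr0.
Qed.

Lemma excursion_total_natS phi n (x : nat) : excursion_total phi n.+1 x.+1%:Z =
  excursion_total (fun t => phi (a x.+1 + t)) n x%:Z +
  excursion_total (fun t => phi (a x.+2 + t)) n x.+2%:Z.
Proof.
rewrite excursion_totalS big_mkcond big_bool/=.
by rewrite edge_level_up edge_level_down Posz_up Posz_down addrC.
Qed.

End SignSequences.

(** * Moments of additive functionals *)

Section Kernels.
Variable R : realType.
Implicit Types (f g : {poly R}) (K : nat -> nat -> R).

Definition walk_kernel (n x : nat) : R := (walks n x)%:R.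

Lemma step_walk_kernel : step_kernel walk_kernel.
Proof.
split=> [n x nx|n x]; first by rewrite /walk_kernel walks_gt.
by rewrite /walk_kernel /= natrD.
Qed.

(** The kernel K divided by 1 - 'X, in the sense of [wpair_tail_kernel]. *)
Definition tail_kernel K (n x : nat) : R := \sum_(j < n.+1) K n (x + j.*2)%N.

Lemma tail_kernel_rec K n x : step_kernel K ->
  tail_kernel K n x = K n x + tail_kernel K n x.+2.
Proof.
move=> HK; rewrite /tail_kernel big_ord_recl/= addn0; congr (_ + _).
rewrite [RHS]big_ord_recr/= [X in _ + X](proj1 HK) ?addr0.
  by apply: eq_bigr => i _; rewrite /bump/= add1n doubleS !addnS !addSn.
by lia.
Qed.

Lemma step_tail_kernel K : step_kernel K -> step_kernel (tail_kernel K).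
Proof.
move=> HK; split=> [n x nx|n x].
  by rewrite /tail_kernel big1// => j _; rewrite (proj1 HK)// (leq_trans nx)// leq_addr.
rewrite /tail_kernel [LHS]big_ord_recr/= [X in _ + X](proj1 HK); last first.
  by lia.
rewrite addr0 -big_split; apply: eq_bigr => j _ /=.
by rewrite addSn (proj2 HK) !addSn.
Qed.

Lemma wpair_tail_kernel K n x f : step_kernel K ->
  wpair (tail_kernel K) n x ((1 - 'X) * f) = wpair K n x f.
Proof.
move=> HK; rewrite mulrBl mul1r wpairD -scaleN1r wpairZ wpairX; last first.
  exact: step_tail_kernel.
rewrite mulN1r /wpair -sumrB; apply: eq_bigr => j _.
by rewrite -mulrBr tail_kernel_rec// !addSn addrK.
Qed.

Lemma wpair1 K n x : wpair K n x 1 = K n x.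
Proof.
rewrite /wpair big_ord_recl/= coef1 mul1r addn0 big1 ?addr0// => i _.
by rewrite coef1 mul0r.
Qed.

Lemma wpair_quadratic K n x (c : R) f g :
  wpair K n x (2 * c%:P * f + c%:P ^+ 2 * g) =
  2 * c * wpair K n x f + c ^+ 2 * wpair K n x g.
Proof. by rewrite wpairD -(polyC_natr R 2) -polyCM -polyC_exp !mul_polyC !wpairZ. Qed.

Definition cumsum (u : nat -> R) (m : nat) : R := \sum_(i < m.+1) u i.

Lemma cumsumS u m : cumsum u m.+1 = cumsum u m + u m.+1.
Proof. by rewrite /cumsum big_ord_recr. Qed.

(** Summation by parts: at level 0, a division by 1 - 'X in the kernel becomes a cumulative sum of
    the coefficients. *)
Lemma sum_tail_kernel K n (u : nat -> R) : step_kernel K ->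
  \sum_(j < n.+1) u j * tail_kernel K n j.*2 = \sum_(j < n.+1) cumsum u j * K n j.*2.
Proof.
move=> HK.
have E m : \sum_(j < m.+1) u j * tail_kernel K n j.*2 =
    \sum_(j < m.+1) cumsum u j * K n j.*2 + cumsum u m * tail_kernel K n m.+1.*2.
  elim: m => [|m IH].
    by rewrite !big_ord1 /cumsum big_ord1 -mulrDr; congr (_ * _); exact: tail_kernel_rec.
  rewrite big_ord_recr/= IH [in RHS]big_ord_recr/= -!addrA; congr (_ + _).
  by rewrite -mulrDr (tail_kernel_rec _ m.+1.*2 HK) cumsumS; ring.
rewrite E (proj1 (step_tail_kernel HK)) ?mulr0 ?addr0//.
by lia.
Qed.

End Kernels.

(** * Exact moments for weights of finite support *)

Section TruncatedMoments.
Variables (R : realType) (a : nat -> R) (L : nat).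
Hypothesis aL : forall h, (L < h)%N -> a h = 0.
Hypothesis a0 : a 0%N = 0.

Let W := @walk_kernel R.
Let T := tail_kernel W.
Let TT := tail_kernel T.
Let HW : step_kernel W := step_walk_kernel R.
Let HT : step_kernel T := step_tail_kernel HW.
Let HTT : step_kernel TT := step_tail_kernel HT.

Lemma ends_at0_nil (x : nat) (s : {ffun 'I_0 -> bool}) : ends_at0 x%:Z s = (x == 0)%N.
Proof. by rewrite /ends_at0 big_ord0 addr0. Qed.

Lemma sum_ffun0 (P : pred {ffun 'I_0 -> bool}) (F : {ffun 'I_0 -> bool} -> R) (b : bool) c :
  (forall s, P s = b) -> (forall s, F s = c) -> \sum_(s | P s) F s = b%:R * c.
Proof.
move=> HP HF; rewrite (eq_bigl (fun=> b))//.
case: b {HP}; last by rewrite big_pred0// mul0r.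
by rewrite (eq_bigr (fun=> c))// sumr_const card_ffun card_ord expn0 mul1r.
Qed.

Lemma walk_sum_nil x (s : {ffun 'I_0 -> bool}) : walk_sum a x s = 0.
Proof. by rewrite /walk_sum big_ord0. Qed.

Lemma bridge_total_nil phi (x : nat) :
  bridge_total a phi 0 x%:Z = (x == 0)%N%:R * phi 0.
Proof.
apply: sum_ffun0 => s; first exact: ends_at0_nil.
by rewrite walk_sum_nil.
Qed.

Lemma excursion_total_nil phi (x : nat) :
  excursion_total a phi 0 x%:Z = (x == 0)%N%:R * phi 0.
Proof.
apply: sum_ffun0 => s; last by rewrite walk_sum_nil.
rewrite ends_at0_nil; case: eqP => //= ->.
by apply/forallP => -[].
Qed.

Lemma bridge_totalD n x c :
  bridge_total a (fun t => c + t) n x =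
  c * bridge_total a (fun=> 1) n x + bridge_total a id n x.
Proof. by rewrite mulr_sumr -big_split; apply: eq_bigr => s _; rewrite mulr1. Qed.

Lemma bridge_totalX2 n x c :
  bridge_total a (fun t => (c + t) ^+ 2) n x =
  c ^+ 2 * bridge_total a (fun=> 1) n x + 2 * c * bridge_total a id n x +
  bridge_total a (fun t => t ^+ 2) n x.
Proof.
by rewrite !mulr_sumr -!big_split; apply: eq_bigr => s _ /=; ring.
Qed.

Lemma excursion_totalD n x c :
  excursion_total a (fun t => c + t) n x =
  c * excursion_total a (fun=> 1) n x + excursion_total a id n x.
Proof. by rewrite mulr_sumr -big_split; apply: eq_bigr => s _; rewrite mulr1. Qed.

Lemma excursion_totalX2 n x c :
  excursion_total a (fun t => (c + t) ^+ 2) n x =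
  c ^+ 2 * excursion_total a (fun=> 1) n x + 2 * c * excursion_total a id n x +
  excursion_total a (fun t => t ^+ 2) n x.
Proof.
by rewrite !mulr_sumr -!big_split; apply: eq_bigr => s _ /=; ring.
Qed.

Lemma bridge_count n (x : nat) : bridge_total a (fun=> 1) n x%:Z = W n x.
Proof.
elim: n x => [|n IH] [|x].
- by rewrite bridge_total_nil mul1r.
- by rewrite bridge_total_nil mul0r.
- rewrite bridge_total_nat0 (IH 1%N) /W /walk_kernel /= -muln2 natrM mulrC.
  by [].
- by rewrite bridge_total_natS !IH (proj2 HW).
Qed.

Lemma excursion_count n (x : nat) :
  excursion_total a (fun=> 1) n x%:Z = W n x - W n x.+2.
Proof.
elim: n x => [|n IH] [|x].
- by rewrite excursion_total_nil mul1r subr0.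
- by rewrite excursion_total_nil mul0r subr0.
- rewrite excursion_total_nat0 (IH 1%N) (proj2 HW) {3}/W /walk_kernel /= -muln2 natrM.
  by rewrite -/(W n 1); ring.
- by rewrite excursion_total_natS !IH !(proj2 HW); ring.
Qed.

(** For bridges the count, the first and the second moment carry the denominators 1, 1 - 'X and (1 -
    'X)^2. One recursion has to contain all three, so each is written with the kernel [TT] of the
    last one. *)
Lemma walk_kernel_tail2 n x : W n x = wpair TT n x ((1 - 'X) ^+ 2).
Proof. by rewrite expr2 wpair_tail_kernel// -(mulr1 (1 - 'X)) wpair_tail_kernel// wpair1. Qed.

Lemma bridge_moment1 n (x : nat) :
  bridge_total a id n x%:Z = wpair TT n x ((1 - 'X) * bridge_poly1 a L x).
Proof.
move: n x; apply: (@walk_poly _ _ _ _ (fun x => (a x.+1)%:P * (1 - 'X) ^+ 2)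
  (fun x => (a x.+1)%:P * (1 - 'X) ^+ 2) 2 ((1 - 'X) * (4 * shift_poly a L 1)) HTT).
- by rewrite bridge_poly1_0; ring.
(* The boundary condition concerns [bridge_poly1 a L 0] divided by 'X, while [bridge_poly1_bd] keeps
   that factor; it is restored and then cancelled. *)
- apply: (mulfI (negbT (polyX_eq0 R))); rewrite -mul_polyC polyC_natr.
  transitivity ((1 - 'X) * ((1 + 'X) * bridge_poly1 a L 0)).
    by rewrite bridge_poly1_0; ring.
  by rewrite bridge_poly1_bd//; ring.
- by move=> x; rewrite mulrCA bridge_poly1_rec//; ring.
- by move=> x; rewrite bridge_total_nil mulr0.
- move=> n; rewrite bridge_total_nat0 bridge_totalD (bridge_count n 1) walk_kernel_tail2.
  by rewrite mul_polyC wpairZ addrC.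
- move=> n x; rewrite bridge_total_natS !bridge_totalD !bridge_count !walk_kernel_tail2.
  by rewrite !mul_polyC !wpairZ; ring.
Qed.

Lemma bridge_moment2 n (x : nat) :
  bridge_total a (fun t => t ^+ 2) n x%:Z = wpair TT n x (bridge_poly2 a L x).
Proof.
move: n x; apply: (@walk_poly _ _ _ _
  (fun x => 2 * (a x.+1)%:P * ((1 - 'X) * bridge_poly1 a L x) +
     (a x.+1)%:P ^+ 2 * (1 - 'X) ^+ 2)
  (fun x => 2 * (a x.+1)%:P * ((1 - 'X) * bridge_poly1 a L x.+1) +
     (a x.+1)%:P ^+ 2 * (1 - 'X) ^+ 2) 2
  (16 * 'X * shift_poly a L 1 ^+ 2 +
   8 * (1 + 'X) * ((1 - 'X) * tail_squares a L 1 + shift_poly a L 1 ^+ 2)) HTT).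
- by rewrite /bridge_poly2 bridge_poly1_0 big_ord0; ring.
- apply: (mulfI (negbT (polyX_eq0 R))); rewrite -mul_polyC polyC_natr.
  transitivity ((1 + 'X) * bridge_poly2 a L 0); last by rewrite bridge_poly2_bd//; ring.
  by rewrite /bridge_poly2 bridge_poly1_0 big_ord0; ring.
- by move=> x; rewrite bridge_poly2_rec//; ring.
- by move=> x; rewrite bridge_total_nil expr0n mulr0.
- move=> n; rewrite bridge_total_nat0 bridge_totalX2 (bridge_count n 1) walk_kernel_tail2.
  by rewrite (bridge_moment1 n 1) wpair_quadratic; ring.
- move=> n x; rewrite bridge_total_natS !bridge_totalX2 !bridge_count !walk_kernel_tail2.
  by rewrite !bridge_moment1 !wpair_quadratic; ring.
Qed.

Lemma excursion_kernel n x : W n x - W n x.+2 = wpair W n x (1 - 'X).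
Proof.
rewrite wpairD -[- 'X]scaleN1r wpairZ mulN1r wpair1 -(mulr1 'X) wpairX//.
by rewrite wpair1.
Qed.

Lemma excursion_moment1 n (x : nat) :
  excursion_total a id n x%:Z = wpair W n x ((1 - 'X) * excursion_poly1 a L x).
Proof.
move: n x; apply: (@walk_poly _ _ _ _ (fun x => (a x.+1)%:P * (1 - 'X))
  (fun x => (a x.+1)%:P * (1 - 'X)) 1 ((1 - 'X) * (2 * shift_poly a L 1)) HW).
- by rewrite excursion_poly1_0; ring.
- apply: (mulfI (negbT (polyX_eq0 R))); rewrite scale1r.
  transitivity ((1 - 'X) * ((1 + 'X) * excursion_poly1 a L 0)).
    by rewrite excursion_poly1_0; ring.
  by rewrite excursion_poly1_bd//; ring.
- by move=> x; rewrite mulrCA excursion_poly1_rec//; ring.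
- by move=> x; rewrite excursion_total_nil mulr0.
- move=> n; rewrite excursion_total_nat0 excursion_totalD (excursion_count n 1).
  by rewrite excursion_kernel mul_polyC wpairZ addrC mul1r.
- move=> n x; rewrite excursion_total_natS !excursion_totalD !excursion_count.
  by rewrite !excursion_kernel !mul_polyC !wpairZ; ring.
Qed.

Lemma excursion_moment2 n (x : nat) :
  excursion_total a (fun t => t ^+ 2) n x%:Z =
  wpair W n x ((1 - 'X) * excursion_poly2 a L x).
Proof.
move: n x; apply: (@walk_poly _ _ _ _
  (fun x => 2 * (a x.+1)%:P * ((1 - 'X) * excursion_poly1 a L x) +
     (a x.+1)%:P ^+ 2 * (1 - 'X))
  (fun x => 2 * (a x.+1)%:P * ((1 - 'X) * excursion_poly1 a L x.+1) +
     (a x.+1)%:P ^+ 2 * (1 - 'X)) 1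
  ((1 - 'X) * (4 * 'X * shift_poly a L 1 ^+ 2 +
   4 * (1 + 'X) * (shift_poly a L 1 ^+ 2 + tail_squares a L 1))) HW).
- rewrite /excursion_poly2 excursion_poly1_0 big_ord1/= (tail_squaresE aL 0); ring.
- apply: (mulfI (negbT (polyX_eq0 R))); rewrite scale1r.
  transitivity ((1 - 'X) * ((1 + 'X) * excursion_poly2 a L 0)).
    by rewrite /excursion_poly2 excursion_poly1_0 big_ord1/= (tail_squaresE aL 0); ring.
  by rewrite excursion_poly2_bd//; ring.
- by move=> x; rewrite mulrCA excursion_poly2_rec//; ring.
- by move=> x; rewrite excursion_total_nil expr0n mulr0.
- move=> n; rewrite excursion_total_nat0 excursion_totalX2 (excursion_count n 1).
  by rewrite (excursion_moment1 n 1) excursion_kernel wpair_quadratic; ring.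
- move=> n x; rewrite excursion_total_natS !excursion_totalX2 !excursion_count.
  by rewrite !excursion_kernel !excursion_moment1 !wpair_quadratic; ring.
Qed.

End TruncatedMoments.

Lemma edge_level_le n (s : {ffun 'I_n -> bool}) (i : 'I_n) :
  (edge_level (position 0 s i) (s i) <= n.+1)%N.
Proof.
have sgn1 b : `|sgn_step b| = 1%N%:Z by case: b.
have H : `|position 0 s i| <= n%:Z.
  rewrite /position add0r (le_trans (ler_norm_sum _ _ _))//.
  rewrite (eq_bigr (fun=> 1)) => [|j _]; last exact: sgn1.
  rewrite sumr_const -natz ler_nat (leq_trans (max_card _))//.
  by rewrite card_ord.
rewrite /edge_level geq_max -!lez_nat !abszE -addn1 PoszD.
rewrite (le_trans H) ?lerDl// (le_trans (ler_normD _ _))//.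
by rewrite lerD// sgn1.
Qed.

Section Moments.
Variables (R : realType) (a : nat -> R).
Hypothesis a0 : a 0%N = 0.
Let W := @walk_kernel R.

(** For j > 0 this is [cumsum u j ^+ 2 - cumsum u j.-1 ^+ 2], the sum of u h * u k over the pairs
    with maximum j. *)
Definition square_diff (u : nat -> R) j := u j * (2 * cumsum u j - u j).

Definition convolution (u v : nat -> R) j := \sum_(i < j.+1) u i * v (j - i)%N.

(** At j = 0 the predecessor is again 0. This agrees with the coefficient of a multiple of 'X, which
    is 0, as soon as u 0 = 0. *)
Definition bridge_coef u j :=
  8 * (square_diff u j + square_diff u j.-1) + 16 * convolution u u j.

Definition excursion_coef u j :=
  4 * (square_diff u j + square_diff u j.-1) - 8 * convolution u u j.-1.

Lemma square_diff0 : square_diff a 0 = 0.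
Proof. by rewrite /square_diff a0 mul0r. Qed.

Section Coefficients.
Variable L : nat.
Hypothesis aL : forall h, (L < h)%N -> a h = 0.

Lemma coef_max_poly j : (max_poly a L 0)`_j = square_diff a j.
Proof.
case: j => [|j]; first by rewrite (coef_max_poly0 aL) square_diff0.
rewrite (coef_max_polyS aL) /square_diff /cumsum [in RHS]big_ord_recl/= a0 !add0r.
by [].
Qed.

Lemma coef_1DX (p : {poly R}) (u : nat -> R) j : u 0%N = 0 -> (forall i, p`_i = u i) ->
  ((1 + 'X) * p)`_j = u j + u j.-1.
Proof.
by move=> u0 pu; rewrite mulrDl mul1r coefD coefXM !pu; case: j => [|j] //=; rewrite u0.
Qed.

Lemma coef_shift_poly_sqr j : (shift_poly a L 0 ^+ 2)`_j = convolution a a j.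
Proof.
rewrite expr2 coefM; apply: eq_bigr => i _.
by rewrite !(coef_shift_poly aL) !add0n.
Qed.

Lemma coef_natM (p : {poly R}) m j : (m%:R * p)`_j = m%:R * p`_j.
Proof. by rewrite -polyC_natr coefCM. Qed.

Lemma coef_bridge_poly2 j : (bridge_poly2 a L 0)`_j = bridge_coef a j.
Proof.
rewrite (bridge_poly2_0 aL a0) coefD -mulrA !coef_natM coef_shift_poly_sqr.
by rewrite (coef_1DX _ square_diff0 coef_max_poly).
Qed.

Lemma coef_excursion_poly2 j :
  ((1 - 'X) * excursion_poly2 a L 0)`_j = excursion_coef a j.
Proof.
rewrite (excursion_poly2_0 aL a0) coefB -!mulrA !coef_natM.
rewrite (coef_1DX _ square_diff0 coef_max_poly) coefXM !coef_shift_poly_sqr.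
case: j => [|j] //=; rewrite /excursion_coef /= /convolution big_ord1 a0 mul0r//.
Qed.

(** The explicit factor 1 - 'X cancels one of the two tail sums and the other one becomes a
    [cumsum]. In the second moment nothing cancels, hence its double [cumsum]. *)
Lemma truncated_bridge_moment1 n : bridge_total a id n 0 =
  4 * \sum_(j < n.+1) cumsum a j * W n j.*2.
Proof.
rewrite (bridge_moment1 aL n 0) bridge_poly1_0 wpair_tail_kernel; last first.
  exact/step_tail_kernel/step_walk_kernel.
rewrite -sum_tail_kernel; last exact: step_walk_kernel.
rewrite mulr_sumr; apply: eq_bigr => j _; rewrite mulrCA coef_natM add0n mulrA.
congr (_ * _ * _); rewrite coefXM (coef_shift_poly aL).
by case: (val j) => [|i] //=; rewrite a0.
Qed.

Lemma truncated_bridge_moment2 n : bridge_total a (fun t => t ^+ 2) n 0 =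
  \sum_(j < n.+1) cumsum (cumsum (bridge_coef a)) j * W n j.*2.
Proof.
rewrite (bridge_moment2 aL a0 n 0) -!sum_tail_kernel; last 2 first.
- exact/step_tail_kernel/step_walk_kernel.
- exact: step_walk_kernel.
by apply: eq_bigr => j _; rewrite add0n coef_bridge_poly2.
Qed.

Lemma truncated_excursion_moment1 n : excursion_total a id n 0 =
  \sum_(j < n.+1) 2 * (a j - a j.-1) * W n j.*2.
Proof.
rewrite (excursion_moment1 aL n 0) excursion_poly1_0.
apply: eq_bigr => j _; rewrite add0n; congr (_ * _).
rewrite mulrC -!mulrA coef_natM coefXM mulrBr mulr1 coefB (mulrC _ 'X) coefXM !(coef_shift_poly aL).
case: (val j) => [|[|i]] //=; rewrite ?a0 ?subrr//.
Qed.

Lemma truncated_excursion_moment2 n : excursion_total a (fun t => t ^+ 2) n 0 =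
  \sum_(j < n.+1) excursion_coef a j * W n j.*2.
Proof.
rewrite (excursion_moment2 aL n 0).
by apply: eq_bigr => j _; rewrite add0n coef_excursion_poly2.
Qed.

End Coefficients.
End Moments.

(** * Removal of the truncation *)

Section GeneralMoments.
Variables (R : realType) (a : nat -> R).
Hypothesis a0 : a 0%N = 0.
Let W := @walk_kernel R.

(** By [edge_level_le] an n-step walk from 0 only meets labels up to n + 1, so it does not see the
    cut-off. The resulting formulas only involve the weight at indices up to n, where [trunc n]
    coincides with [a]. *)
Let trunc n h := if (h <= n.+1)%N then a h else 0.

Let truncL n h : (n.+1 < h)%N -> trunc n h = 0.
Proof. by rewrite /trunc ltnNge => /negbTE ->. Qed.

Let trunc0 n : trunc n 0 = 0.
Proof. by rewrite /trunc a0. Qed.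

Let truncE n h : (h <= n)%N -> trunc n h = a h.
Proof. by move=> hn; rewrite /trunc leqW. Qed.

Let walk_sum_trunc n (s : {ffun 'I_n -> bool}) :
  walk_sum a 0 s = walk_sum (trunc n) 0 s.
Proof. by apply: eq_bigr => i _; rewrite /trunc edge_level_le. Qed.

Let bridge_trunc phi n : bridge_total a phi n 0 = bridge_total (trunc n) phi n 0.
Proof. by apply: eq_bigr => s _; rewrite walk_sum_trunc. Qed.

Let excursion_trunc phi n :
  excursion_total a phi n 0 = excursion_total (trunc n) phi n 0.
Proof. by apply: eq_bigr => s _; rewrite walk_sum_trunc. Qed.

Lemma eq_cumsum (u v : nat -> R) j : (forall i, (i <= j)%N -> u i = v i) ->
  cumsum u j = cumsum v j.
Proof. by move=> uv; apply: eq_bigr => i _; rewrite uv// -ltnS. Qed.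

Let square_diff_trunc n j : (j <= n)%N -> square_diff (trunc n) j = square_diff a j.
Proof.
move=> jn; rewrite /square_diff truncE// (eq_cumsum (v := a))// => i ij.
by rewrite truncE// (leq_trans ij).
Qed.

Let convolution_trunc n j : (j <= n)%N ->
  convolution (trunc n) (trunc n) j = convolution a a j.
Proof.
move=> jn; apply: eq_bigr => i _; rewrite !truncE// (leq_trans _ jn)// ?leq_subr//.
by rewrite -ltnS.
Qed.

Lemma bridge_sum_moment1 n : bridge_total a id n 0 =
  4 * \sum_(j < n.+1) cumsum a j * W n j.*2.
Proof.
rewrite bridge_trunc (truncated_bridge_moment1 (@trunc0 n) (@truncL n)).
congr (_ * _); apply: eq_bigr => j _; congr (_ * _); apply: eq_cumsum => i ij.
by rewrite truncE// (leq_trans ij)// -ltnS.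
Qed.

Lemma bridge_sum_moment2 n : bridge_total a (fun t => t ^+ 2) n 0 =
  \sum_(j < n.+1) cumsum (cumsum (bridge_coef a)) j * W n j.*2.
Proof.
rewrite bridge_trunc (truncated_bridge_moment2 (@trunc0 n) (@truncL n)).
apply: eq_bigr => j _; congr (_ * _); apply: eq_cumsum => i ij.
apply: eq_cumsum => k ki; have kn : (k <= n)%N.
  by rewrite (leq_trans ki)// (leq_trans ij)// -ltnS.
rewrite /bridge_coef !square_diff_trunc// ?convolution_trunc//.
by rewrite (leq_trans (leq_pred _)).
Qed.

Lemma excursion_sum_moment1 n : excursion_total a id n 0 =
  \sum_(j < n.+1) 2 * (a j - a j.-1) * W n j.*2.
Proof.
rewrite excursion_trunc (truncated_excursion_moment1 (@trunc0 n) (@truncL n)).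
apply: eq_bigr => j _; rewrite !truncE// -ltnS//.
by rewrite (leq_ltn_trans (leq_pred _)).
Qed.

Lemma excursion_sum_moment2 n : excursion_total a (fun t => t ^+ 2) n 0 =
  \sum_(j < n.+1) excursion_coef a j * W n j.*2.
Proof.
rewrite excursion_trunc (truncated_excursion_moment2 (@trunc0 n) (@truncL n)).
apply: eq_bigr => j _; congr (_ * _); have jn : (j <= n)%N by rewrite -ltnS.
by rewrite /excursion_coef !square_diff_trunc// ?convolution_trunc//;
  rewrite (leq_trans (leq_pred _)).
Qed.

End GeneralMoments.

(** * Sums against ratios of binomial coefficients *)

Section CentralRatio.
Variable R : realType.
Implicit Types (F G : nat -> R).

(* central_ratio N m = binomial(2N, N + m) / binomial(2N, N). *)
Fixpoint central_ratio (N m : nat) : R :=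
  if m is m'.+1 then central_ratio N m' * (N%:R - m'%:R) / (N + m'.+1)%:R else 1.

Local Notation r := central_ratio.

Lemma central_ratio_rec N m :
  (N%:R + m%:R + 1) * r N m.+1 = (N%:R - m%:R) * r N m.
Proof.
have -> : N%:R + m%:R + 1 = (N + m.+1)%:R :> R by rewrite addnS -natr1 natrD.
by rewrite /= mulrCA divff ?mulr1 1?mulrC// pnatr_eq0 addnS.
Qed.

Lemma central_ratio_gt N m : (N < m)%N -> r N m = 0.
Proof.
elim: m => // m IH; rewrite ltnS leq_eqVlt => /predU1P[<-|Nm] /=.
  by rewrite subrr mulr0 mul0r.
by rewrite IH// !mul0r.
Qed.

Lemma central_ratio_ge0 N m : 0 <= r N m.
Proof.
elim: m => //= m IH; case: (ltnP N m) => Nm; first by rewrite central_ratio_gt// !mul0r.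
by rewrite divr_ge0// mulr_ge0// subr_ge0 ler_nat.
Qed.

Lemma central_ratioSN N m :
  ((N.+1)%:R ^+ 2 - m%:R ^+ 2) * r N.+1 m = N.+1%:R ^+ 2 * r N m.
Proof.
elim: m => [|m IH]; first by rewrite /= expr0n subr0.
have h1 : (N%:R + m%:R + 1 : R) != 0.
  by rewrite -natrD natr1 pnatr_eq0.
apply: (mulfI h1); rewrite -!natr1.
have R1 := central_ratio_rec N.+1 m; have R2 := central_ratio_rec N m.
rewrite -!natr1 in IH R1 R2.
transitivity ((N%:R + m%:R + 1) * (N%:R - m%:R) *
   ((N%:R + 1 + m%:R + 1) * r N.+1 m.+1)); first by ring.
rewrite R1.
transitivity ((N%:R - m%:R) * (((N%:R + 1) ^+ 2 - m%:R ^+ 2) * r N.+1 m)); first by ring.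
rewrite IH; transitivity ((N%:R + 1) ^+ 2 * ((N%:R - m%:R) * r N m)); first by ring.
by rewrite -R2; ring.
Qed.

#[local] Arguments central_ratio : simpl never.

Definition ratio_sum N F : R := \sum_(m < N) F m.+1 * r N m.+1.

Lemma eq_ratio_sum N F G :
  (forall m, (0 < m <= N)%N -> F m = G m) -> ratio_sum N F = ratio_sum N G.
Proof. by move=> FG; rewrite /ratio_sum; apply: eq_bigr => m _; rewrite FG//= ltn_ord. Qed.

Lemma ratio_sumD N F G :
  ratio_sum N (fun m => F m + G m) = ratio_sum N F + ratio_sum N G.
Proof. by rewrite -big_split; apply: eq_bigr => m _; rewrite mulrDl. Qed.

Lemma ratio_sumZ N c F : ratio_sum N (fun m => c * F m) = c * ratio_sum N F.
Proof. by rewrite mulr_sumr; apply: eq_bigr => m _; rewrite mulrA. Qed.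

Lemma ratio_sum_ler N F G :
  (forall m, (0 < m <= N)%N -> F m <= G m) -> ratio_sum N F <= ratio_sum N G.
Proof.
by move=> FG; rewrite /ratio_sum; apply: ler_sum => m _; rewrite ler_wpM2r ?central_ratio_ge0// FG//= ltn_ord.
Qed.

Lemma ratio_sum_norm N F : `|ratio_sum N F| <= ratio_sum N (fun m => `|F m|).
Proof.
apply: le_trans (ler_norm_sum _ _ _) _; apply: ler_sum => m _.
by rewrite normrM [X in _ * X]ger0_norm ?central_ratio_ge0.
Qed.

Lemma ratio_sum_widen N F M : (N <= M)%N ->
  ratio_sum N F = \sum_(m < M) F m.+1 * r N m.+1.
Proof.
move=> NM; rewrite /ratio_sum (big_ord_widen _ (fun m => F m.+1 * r N m.+1) NM).
rewrite big_mkcond; apply: eq_bigr => i _; case: ltnP => // ni.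
by rewrite central_ratio_gt ?mulr0.
Qed.

Lemma ratio_sumSN N F : ratio_sum N.+1 F = ratio_sum N F +
  ratio_sum N.+1 (fun m => m%:R ^+ 2 * F m) / N.+1%:R ^+ 2.
Proof.
rewrite (ratio_sum_widen F (leqnSn N)) /ratio_sum mulr_suml -big_split/=.
apply: eq_bigr => m _; have H := central_ratioSN N m.+1.
have n0 : N.+1%:R != 0 :> R by rewrite pnatr_eq0.
have -> : r N m.+1 = (N.+1%:R ^+ 2 - m.+1%:R ^+ 2) * r N.+1 m.+1 / N.+1%:R ^+ 2.
  by rewrite H mulrAC divff ?mul1r// expf_neq0.
by move: (r N.+1 m.+1) (F m.+1) (N.+1%:R) (m.+1%:R) n0 => x y z t z0; field.
Qed.

(* Summation by parts: m * r N m = t m - t m.+1 for t m = (N + m) * r N m / 2. *)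
Lemma ratio_sum_parts N F : F 0%N = 0 ->
  ratio_sum N (fun m => m%:R * F m) =
  2^-1 * ratio_sum N (fun m => (N%:R + m%:R) * (F m - F m.-1)).
Proof.
move=> F0; pose t m := (N%:R + m%:R) * r N m.
have tE m : m%:R * r N m = 2^-1 * (t m - t m.+1).
  by rewrite /t -(natr1 m) addrA central_ratio_rec; field.
have H M : \sum_(m < M) m.+1%:R * F m.+1 * r N m.+1 =
  2^-1 * (\sum_(m < M) (N%:R + m.+1%:R) * (F m.+1 - F m) * r N m.+1 - F M * t M.+1).
  elim: M => [|M IH]; first by rewrite !big_ord0 F0 mul0r subrr mulr0.
  rewrite !big_ord_recr/= IH mulrAC tE /t; ring.
rewrite /ratio_sum H; congr (_ * _); rewrite /t central_ratio_gt// !mulr0 subr0.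
by apply: eq_bigr.
Qed.

Definition hsum (n : nat) : R := series harmonic n.
Definition hsum2 (n : nat) : R := \sum_(k < n) (k.+1%:R ^+ 2)^-1.

Lemma hsum_0 : hsum 0 = 0. Proof. by rewrite /hsum /series /= big_geq. Qed.

Lemma hsumS n : hsum n.+1 = hsum n + n.+1%:R^-1. Proof. by rewrite /hsum seriesSr. Qed.

Lemma hsum2_0 : hsum2 0 = 0. Proof. by rewrite /hsum2 big_ord0. Qed.

Lemma hsum2S n : hsum2 n.+1 = hsum2 n + (n.+1%:R ^+ 2)^-1. Proof. by rewrite /hsum2 big_ord_recr. Qed.

Lemma add1n_neq0 n : 1 + n%:R != 0 :> R.
Proof. by rewrite nat1r pnatr_eq0. Qed.

Lemma ratio_sum_id N : ratio_sum N (fun m => m%:R) = N%:R / 2.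
Proof.
case: N => [|N]; first by rewrite /ratio_sum big_ord0 mul0r.
(* The constant 1 is replaced by the indicator of m > 0, which vanishes at 0 as summation by parts
   requires; its only nonzero increment is at m = 1. *)
transitivity (ratio_sum N.+1 (fun m => m%:R * (0 < m)%N%:R)).
  by apply: eq_ratio_sum => -[|m] //; rewrite mulr1.
rewrite ratio_sum_parts// /ratio_sum big_ord_recl/= big1 => [|i _].
  have := central_ratio_rec N.+1 0; rewrite addr0 subr0 [r N.+1 0]/central_ratio mulr1.
  by rewrite subr0 mulr1 addr0 => ->; rewrite mulrC.
by rewrite /bump/= subrr mulr0 mul0r.
Qed.

Lemma ratio_sum_inv N : ratio_sum N (fun m => m%:R^-1) = hsum N / 2.
Proof.
elim: N => [|N IH]; first by rewrite /ratio_sum big_ord0 hsum_0 mul0r.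
rewrite ratio_sumSN IH (@eq_ratio_sum _ _ (fun m => m%:R)) => [|[|m]//= _]; last first.
  by rewrite expr2 mulfK ?pnatr_eq0.
by rewrite ratio_sum_id hsumS; field; rewrite ?add1n_neq0.
Qed.

Lemma ratio_sum_mhsum N : ratio_sum N (fun m => m%:R * hsum m) =
  N%:R * hsum N / 4 + ratio_sum N (fun=> 1) / 2.
Proof.
rewrite ratio_sum_parts ?hsum_0// (@eq_ratio_sum _ _ (fun m => N%:R * m%:R^-1 + 1)).
  by rewrite ratio_sumD ratio_sumZ ratio_sum_inv; field.
move=> [|m]//= _; rewrite hsumS; by field; rewrite ?add1n_neq0.
Qed.

(** From N to N + 1 the left side grows by the sum of [ratio_sum_mhsum] divided by (N + 1)^2. The
    term in [ratio_sum N.+1 (fun=> 1)] produced there is half the growth of the sum of r(m) / m^2,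
    which is therefore kept unevaluated on the right. *)
Lemma ratio_sum_hsum_div N : ratio_sum N (fun m => hsum m / m%:R) =
  (hsum N ^+ 2 + hsum2 N) / 8 + ratio_sum N (fun m => (m%:R ^+ 2)^-1) / 2.
Proof.
elim: N => [|N IH]; first by rewrite /ratio_sum !big_ord0 hsum_0 hsum2_0; field.
rewrite (ratio_sumSN _ (fun m => hsum m / _)) (ratio_sumSN _ (fun m => (m%:R ^+ 2)^-1)) IH.
rewrite (@eq_ratio_sum _ (fun m => m%:R ^+ 2 * (hsum m / m%:R)) (fun m => m%:R * hsum m)) => [|[|m]//= _]; last first.
  by field; rewrite ?add1n_neq0.
rewrite (@eq_ratio_sum _ (fun m => m%:R ^+ 2 / m%:R ^+ 2) (fun=> 1)) => [|[|m]//= _]; last first.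
  by rewrite divff// expf_neq0// pnatr_eq0.
by rewrite ratio_sum_mhsum hsumS hsum2S; field; rewrite ?add1n_neq0.
Qed.

(** The increment of hsum^2 is 2 * hsum m / m - 1 / m^2. Weighted by N + m, its second part cancels
    exactly the unevaluated sum of r(m) / m^2 left by [ratio_sum_hsum_div]. *)
Lemma ratio_sum_mhsumsqr N : ratio_sum N (fun m => m%:R * hsum m ^+ 2) =
  N%:R * (hsum N ^+ 2 + hsum2 N) / 8 + ratio_sum N hsum - hsum N / 4.
Proof.
rewrite (@ratio_sum_parts _ (fun m => hsum m ^+ 2)) ?hsum_0 ?expr0n//.
rewrite (@eq_ratio_sum _ _ (fun m => 2 * N%:R * (hsum m / m%:R) +
  ((- N%:R) * (m%:R ^+ 2)^-1 + (2 * hsum m + (-1) * m%:R^-1)))) => [|[|m]//= _]; last first.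
  by rewrite hsumS; field; rewrite ?add1n_neq0.
by rewrite !ratio_sumD !ratio_sumZ ratio_sum_hsum_div ratio_sum_inv; field.
Qed.

End CentralRatio.

Arguments central_ratio : simpl never.

(** * Harmonic numbers *)

Section HarmonicSums.
Variable R : realType.
Implicit Types (u v : nat -> R).
Local Notation hsum := (@hsum R).
Local Notation hsum2 := (@hsum2 R).

Let inv (n : nat) : R := n%:R^-1.

Lemma convolutionC u v m : convolution u v m = convolution v u m.
Proof.
rewrite /convolution (reindex_inj rev_ord_inj)/=; apply: eq_bigr => i _.
by rewrite subSS subKn 1?mulrC// -ltnS.
Qed.

(** Cumulative sums commute with convolution, so the convolution of harmonic numbers is reached from
    that of 1/n by two summations. *)
Lemma convolution_cumsum u v m : convolution (cumsum u) v m.+1 =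
  convolution (cumsum u) v m + convolution u v m.+1.
Proof.
rewrite /convolution [LHS]big_ord_recl [\sum_(i < m.+2) u i * _]big_ord_recl/= /bump/=.
rewrite addrCA {1}/cumsum big_ord1; congr (_ + _).
rewrite -big_split/=; apply: eq_bigr => i _.
by rewrite add1n subSS cumsumS mulrDl.
Qed.

Lemma cumsum_inv : cumsum inv = hsum.
Proof.
apply/funext => m; elim: m => [|m IH]; first by rewrite /cumsum big_ord1 hsum_0 /inv invr0.
by rewrite cumsumS IH hsumS.
Qed.

(** Partial fractions: 1 / (i (m + 1 - i)) is (1 / i + 1 / (m + 1 - i)) / (m + 1). Since [inv 0] is
    0, the two end products vanish while each end of the decomposed sum equals 1 / (m + 1); removing
    them leaves [hsum m] and not [hsum m.+1]. *)
Lemma convolution_inv m : convolution inv inv m.+1 = 2 * hsum m / m.+1%:R.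
Proof.
have m0 : m.+1%:R != 0 :> R by rewrite pnatr_eq0.
apply: (mulfI m0); rewrite mulrCA divff// mulr1 mulr_sumr.
have E : \sum_(i < m.+2) (inv i + inv (m.+1 - i)) = 2 * hsum m.+1.
  rewrite big_split/= [X in _ + X](reindex_inj rev_ord_inj)/=.
  rewrite [X in _ + X](eq_bigr (fun i : 'I_m.+2 => inv i)) => [|i _].
    by rewrite -/(cumsum inv m.+1) cumsum_inv; ring.
  by rewrite subSS subKn// -ltnS.
have -> : 2 * hsum m = \sum_(i < m.+2) (inv i + inv (m.+1 - i)) - 2 / m.+1%:R.
  by rewrite E hsumS; ring.
rewrite big_ord_recl big_ord_recr [in RHS]big_ord_recl [in RHS]big_ord_recr/=.
rewrite /bump/= add1n subnn subn0 /inv invr0.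
rewrite [X in _ + (X + _)](eq_bigr (fun i : 'I_m => inv (bump 0 i) + inv (m.+1 - bump 0 i))).
  by rewrite /inv; ring.
move=> i _; rewrite /bump/= add1n subSS /inv natrB 1?ltnW//.
have h1 : i.+1%:R != 0 :> R by rewrite pnatr_eq0.
have h2 : m%:R - i%:R != 0 :> R by rewrite subr_eq0 eqr_nat gtn_eqF.
rewrite -[m.+1]add1n -[i.+1]add1n !natrD in h1 m0 *.
by field; rewrite h1 h2.
Qed.

Lemma convolution_hsum_inv m : convolution hsum inv m = hsum m ^+ 2 - hsum2 m.
Proof.
elim: m => [|m IH].
  by rewrite /convolution big_ord1 hsum_0 hsum2_0 mul0r expr0n subr0.
rewrite -{1}cumsum_inv convolution_cumsum cumsum_inv IH convolution_inv hsumS hsum2S.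
by field; rewrite add1n_neq0.
Qed.

Lemma convolution_hsum m : convolution hsum hsum m =
  (m%:R + 1) * (hsum m ^+ 2 - hsum2 m) - 2 * m%:R * hsum m + 2 * m%:R.
Proof.
elim: m => [|m IH].
  by rewrite /convolution big_ord1 hsum_0 hsum2_0; ring.
rewrite -{1}cumsum_inv convolution_cumsum cumsum_inv IH convolutionC.
rewrite convolution_hsum_inv hsumS hsum2S; by field; rewrite add1n_neq0.
Qed.

Lemma cumsum_hsum m : cumsum hsum m = (m%:R + 1) * hsum m - m%:R.
Proof.
elim: m => [|m IH]; first by rewrite /cumsum big_ord1 hsum_0; ring.
by rewrite cumsumS IH hsumS; field; rewrite add1n_neq0.
Qed.

Lemma square_diff_hsum m : square_diff hsum m =
  (2 * m%:R + 1) * hsum m ^+ 2 - 2 * m%:R * hsum m.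
Proof. by rewrite /square_diff cumsum_hsum; ring. Qed.

Lemma cumsum_bridge_coef m : cumsum (bridge_coef hsum) m =
  (24 * m%:R ^+ 2 + 40 * m%:R + 24) * hsum m ^+ 2 -
  56 * (m%:R ^+ 2 + m%:R) * hsum m + (44 * m%:R ^+ 2 + 36 * m%:R) -
  (8 * m%:R ^+ 2 + 24 * m%:R + 16) * hsum2 m.
Proof.
elim: m => [|m IH].
  by rewrite /cumsum big_ord1 /bridge_coef !square_diff_hsum convolution_hsum /= hsum_0 hsum2_0; ring.
rewrite cumsumS IH /bridge_coef !square_diff_hsum convolution_hsum /= !hsumS hsum2S.
by field; rewrite add1n_neq0.
Qed.

(** Only the four cubic coefficients 8, -24, 68/3 and -8/3 enter the main term of the second
    moment. *)
Lemma cumsum2_bridge_coef m : cumsum (cumsum (bridge_coef hsum)) m =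
  (8 * m%:R ^+ 3 + 32 * m%:R ^+ 2 + 48 * m%:R + 24) * hsum m ^+ 2 -
  (24 * m%:R ^+ 3 + 72 * m%:R ^+ 2 + 64 * m%:R + 8 / 3) * hsum m +
  (68 / 3 * m%:R ^+ 3 + 172 / 3 * m%:R ^+ 2 + 128 / 3 * m%:R) -
  (8 / 3 * m%:R ^+ 3 + 16 * m%:R ^+ 2 + 88 / 3 * m%:R + 16) * hsum2 m.
Proof.
elim: m => [|m IH].
  by rewrite /cumsum !big_ord1 /bridge_coef !square_diff_hsum convolution_hsum /= hsum_0 hsum2_0; field.
rewrite cumsumS IH cumsum_bridge_coef hsumS hsum2S.
by field; rewrite add1n_neq0.
Qed.

Lemma excursion_coef_hsum m : (0 < m)%N -> excursion_coef hsum m =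
  4 * ((2 * m%:R + 1) * hsum m ^+ 2 - 2 * m%:R * hsum m +
    (2 * m%:R - 1) * (hsum m - m%:R^-1) ^+ 2 - 2 * (m%:R - 1) * (hsum m - m%:R^-1)) -
  8 * (m%:R * ((hsum m - m%:R^-1) ^+ 2 - (hsum2 m - (m%:R ^+ 2)^-1)) -
    2 * (m%:R - 1) * (hsum m - m%:R^-1) + 2 * (m%:R - 1)).
Proof.
case: m => // m _; rewrite /excursion_coef !square_diff_hsum convolution_hsum /= !hsumS hsum2S.
by field; rewrite add1n_neq0.
Qed.

Lemma hsum_ge0 m : 0 <= hsum m.
Proof. by elim: m => [|m IH]; rewrite ?hsum_0// hsumS addr_ge0// invr_ge0. Qed.

Lemma hsum_le m n : (m <= n)%N -> hsum m <= hsum n.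
Proof.
move=> /subnK <-; elim: (n - m)%N => // k IH.
by rewrite addSn hsumS (le_trans IH)// lerDl invr_ge0.
Qed.

Lemma hsum_ge1 m : (0 < m)%N -> 1 <= hsum m.
Proof. by move=> m0; have := hsum_le m0; rewrite hsumS hsum_0 add0r invr1. Qed.

Lemma hsum2_ge0 m : 0 <= hsum2 m.
Proof. by apply: sumr_ge0 => i _; rewrite invr_ge0 exprn_ge0. Qed.

Lemma hsum2_le2 m : hsum2 m <= 2.
Proof.
(* Subtracting 1 / (m + 1) makes the bound inductive. *)
suff: hsum2 m.+1 <= 2 - m.+1%:R^-1.
  rewrite hsum2S => H; rewrite -subr_ge0; move: H; rewrite -subr_ge0.
  have : 0 <= m.+1%:R^-1 :> R by rewrite invr_ge0.
  have : 0 <= (m.+1%:R ^+ 2)^-1 :> R by rewrite invr_ge0 exprn_ge0.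
  by move: (_^-1) (_^-1) (hsum2 m) => x y z; lra.
elim: m => [|m IH]; first by rewrite hsum2S hsum2_0 expr1n invr1; lra.
rewrite hsum2S; apply: le_trans (lerD IH (lexx _)) _.
rewrite -subr_ge0.
have p1 : 0 < m.+1%:R :> R by [].
have -> : 2 - m.+2%:R^-1 - (2 - m.+1%:R^-1 + (m.+2%:R ^+ 2)^-1) =
   (m.+1%:R * m.+2%:R ^+ 2)^-1 :> R.
  rewrite -[m.+2]addn1 natrD; move: p1; move: (m.+1%:R) => x p1.
  by field; apply/andP; split; apply/eqP; lra.
by rewrite invr_ge0 mulr_ge0// exprn_ge0.
Qed.

End HarmonicSums.

(** * Asymptotics of the moments *)

Section RatioSumAsymptotics.
Variable R : realType.
Local Notation hsum := (@hsum R).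
Local Notation hsum2 := (@hsum2 R).
Local Notation r := (@central_ratio R).

Lemma ratio_sum_sqr N : ratio_sum N (fun m => m%:R ^+ 2 : R) =
  N%:R / 2 * ratio_sum N (fun=> 1 : R) + N%:R / 4.
Proof.
rewrite (@eq_ratio_sum _ _ _ (fun m => m%:R * m%:R)) => [|m _]; last by rewrite expr2.
rewrite ratio_sum_parts// (@eq_ratio_sum _ _ _ (fun m => N%:R * 1 + m%:R)).
  by rewrite ratio_sumD ratio_sumZ ratio_sum_id; field.
by move=> [|m]//= _; rewrite -natr1; ring.
Qed.

Lemma ratio_sum1_ge0 N : 0 <= ratio_sum N (fun=> 1 : R).
Proof. by apply: sumr_ge0 => m _; rewrite mul1r central_ratio_ge0. Qed.

(* With u = 2 * ratio_sum N 1 + 1, one has (2N + 1) u_{N+1} = 2 (N + 1) u_N,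
   and u_N ^ 2 <= 4N + 1 is preserved by this recurrence. *)
Lemma ratio_sum1_le N : ratio_sum N (fun=> 1 : R) <= Num.sqrt N%:R.
Proof.
have rec M : (2 * ratio_sum M.+1 (fun=> 1 : R) + 1) * (2 * M%:R + 1) =
    2 * (M%:R + 1) * (2 * ratio_sum M (fun=> 1 : R) + 1).
  have := ratio_sumSN M (fun=> 1 : R).
  rewrite (@eq_ratio_sum _ _ (fun m => m%:R ^+ 2 * 1) (fun m => m%:R ^+ 2)); last first.
    by move=> m _; rewrite mulr1.
  rewrite ratio_sum_sqr -(natr1 M); have M1 : M%:R + 1 != 0 :> R by rewrite natr1 pnatr_eq0.
  move: (ratio_sum M.+1 _) (ratio_sum M _) (M%:R) M1 => x y n n1 H.
  have {H} : (n + 1) * x = (n + 1) * y + x / 2 + 4^-1.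
    by rewrite {1}H; field.
  lra.
have H M : (2 * ratio_sum M (fun=> 1 : R) + 1) ^+ 2 <= 4 * M%:R + 1.
  elim: M => [|M IH]; first by rewrite /ratio_sum big_ord0; lra.
  move: (rec M) IH; rewrite -(natr1 M); have : 0 <= M%:R :> R by [].
  move: (2 * ratio_sum M.+1 _ + 1) (2 * ratio_sum M _ + 1) (M%:R) => u v n n0 e IH.
  have p : 0 < (2 * n + 1) ^+ 2 by rewrite exprn_gt0//; lra.
  rewrite -(ler_pM2r p) -exprMn e exprMn.
  have q : 0 <= (2 * (n + 1)) ^+ 2 by rewrite sqr_ge0.
  apply: le_trans (ler_wpM2l q IH) _.
  nra.
have S0 := ratio_sum1_ge0 N; have s0 : 0 <= Num.sqrt N%:R :> R by rewrite sqrtr_ge0.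
have sE : Num.sqrt N%:R ^+ 2 = N%:R :> R by rewrite sqr_sqrtr.
have := H N; move: S0 s0 sE; move: (ratio_sum _ _) (Num.sqrt _) => x s x0 s0.
move: (N%:R) => n <- h.
rewrite leNgt; apply/negP => sx.
have : s ^+ 2 <= x ^+ 2 by rewrite !expr2 ler_pM// ltW.
lra.
Qed.

Section Estimates.
Variable N : nat.
Hypothesis N0 : (0 < N)%N.
Let n : R := N%:R.
Let s : R := Num.sqrt n.
Let h : R := hsum N.

Let n1 : 1 <= n. Proof. by rewrite ler1n. Qed.
Let s1 : 1 <= s. Proof. by rewrite -sqrtr1 ler_sqrt// ltr0n. Qed.
Let sE : s * s = n. Proof. by rewrite -expr2 sqr_sqrtr. Qed.
Let h1 : 1 <= h. Proof. exact: hsum_ge1. Qed.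
Let S0 := ratio_sum1_ge0 N.
Let Ss : ratio_sum N (fun=> 1 : R) <= s := ratio_sum1_le N.

Lemma ratio_sum_sqr_le : ratio_sum N (fun m => m%:R ^+ 2 : R) <= n * s.
Proof.
rewrite ratio_sum_sqr -/n; move: S0 Ss n1 s1; move: (ratio_sum _ _) (n) (s) => x y t.
move=> *; nra.
Qed.

Lemma ratio_sum_bound (F G : nat -> R) (K : R) b : 0 <= K ->
  (forall m, (0 < m <= N)%N -> `|F m| <= K * (G m * hsum m ^+ b)) ->
  (forall m, 0 <= G m) ->
  `|ratio_sum N F| <= K * (ratio_sum N G * h ^+ b).
Proof.
move=> K0 FG G0; apply: le_trans (ratio_sum_norm _ _) _.
rewrite mulrA mulrAC -ratio_sumZ.
apply: ratio_sum_ler => m mN; apply: le_trans (FG m mN) _.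
rewrite -mulrAC mulrA ler_wpM2l ?mulr_ge0// lerXn2r ?nnegrE ?hsum_ge0//.
by apply: hsum_le; case/andP: mN.
Qed.

Lemma ratio_sum_hsum_bound : 0 <= ratio_sum N hsum <= s * h.
Proof.
apply/andP; split.
  by apply: sumr_ge0 => m _; rewrite mulr_ge0 ?central_ratio_ge0 ?hsum_ge0.
apply: le_trans (ler_norm _) _.
apply: le_trans (@ratio_sum_bound hsum (fun=> 1) 1 1 ler01 _ (fun=> ler01)) _.
  by move=> m _; rewrite !mul1r expr1 ger0_norm ?hsum_ge0.
by rewrite mul1r expr1 ler_wpM2r ?hsum_ge0.
Qed.

Lemma bridge_mean1 :
  `|4 * ratio_sum N (cumsum hsum) - (n * h - 2 * n)| <= 6 * (s * h).
Proof.
rewrite (@eq_ratio_sum _ _ _ (fun m => m%:R * hsum m + (hsum m + (-1) * m%:R))); last first.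
  by move=> m _; rewrite cumsum_hsum; ring.
rewrite !ratio_sumD ratio_sumZ ratio_sum_mhsum ratio_sum_id -/n -/h.
move: ratio_sum_hsum_bound => /andP[]; move: S0 Ss s1 h1.
move: (ratio_sum N hsum) (ratio_sum N (fun=> 1)) (s) (h) (n) => x y t g k *.
have : t * 1 <= t * g by apply: ler_wpM2l; lra.
rewrite ler_norml; move=> ?; apply/andP; split; lra.
Qed.

Lemma bridge_level_inv :
  4 * ratio_sum N (cumsum (fun m => m%:R^-1)) <= 4 * (s * h).
Proof.
rewrite cumsum_inv ler_wpM2l//.
by case/andP: ratio_sum_hsum_bound.
Qed.

(** No error term: the harmonic sum over Dyck paths has mean exactly (N + 1) * hsum N. *)
Lemma excursion_mean1 : ratio_sum N (fun m => 2 * (hsum m - hsum m.-1)) = h.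
Proof.
rewrite (@eq_ratio_sum _ _ _ (fun m => 2 * m%:R^-1)).
  by rewrite ratio_sumZ ratio_sum_inv mulrC divfK.
by move=> [|m]//= _; rewrite hsumS addrC addKr.
Qed.

(** Bounding term by term would only give order n, because of the factor n + 1. The increments of
    1/m nearly cancel; summation by parts moves them onto r, where r(m) - r(m + 1) = (2m + 1) r(m) /
    (n + m + 1) absorbs that factor. *)
Lemma excursion_level_inv :
  (n + 1) * ratio_sum N (fun m => 2 * (m%:R^-1 - m.-1%:R^-1)) <= 6 * s.
Proof.
have parts (u : nat -> R) M : u 0%N = 0 -> \sum_(m < M) (u m.+1 - u m) * r N m.+1 =
    \sum_(m < M) u m.+1 * (r N m.+1 - r N m.+2) + u M * r N M.+1.
  move=> u0; elim: M => [|M IH]; first by rewrite !big_ord0 u0; ring.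
  by rewrite !big_ord_recr/= IH; ring.
rewrite ratio_sumZ /ratio_sum (parts (fun m => m%:R^-1)) ?invr0// central_ratio_gt//.
rewrite mulr0 addr0.
suff H : (n + 1) * \sum_(m < N) m.+1%:R^-1 * (r N m.+1 - r N m.+2) <= 3 * s.
  by move: H; move: (\sum_(m < N) _) => X; lra.
apply: (@le_trans _ _ (3 * ratio_sum N (fun=> 1))); last by rewrite ler_wpM2l.
rewrite /ratio_sum !mulr_sumr.
apply: ler_sum => m _; rewrite mul1r.
have r0 := central_ratio_ge0 R N m.+1.
have := central_ratio_rec R N m.+1; rewrite -/n.
have k1 : 1 <= m.+1%:R :> R by rewrite ler1n.
move: (m.+1%:R : R) (r N m.+1) (r N m.+2) k1 r0 => k x y k1 x0 e.
have kn : 0 < n + k + 1 by move: n1; lra.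
have -> : y = (n - k) * x / (n + k + 1) by rewrite -e mulrAC divff ?mul1r// gt_eqF.
have -> : (n + 1) * (k^-1 * (x - (n - k) * x / (n + k + 1))) =
   (x * ((n + 1) * (2 * k + 1))) / (k * (n + k + 1)).
  by field; rewrite !gt_eqF//; lra.
rewrite ler_pdivrMr ?mulr_gt0//; last by lra.
rewrite [leRHS](_ : _ = x * (3 * (k * (n + k + 1)))); last by ring.
(* What remains follows from 2k + 1 <= 3k and n + 1 <= n + k + 1. *)
rewrite ler_wpM2l//.
move: n1 k1; move: (n) => j j1 k1; nra.
Qed.

(** Stands for pi^2 / 6; only a crude enclosure and the rate of convergence of [hsum2] are used
    here. *)
Variable z : R.
Hypothesis z03 : 0 <= z <= 3.
Hypothesis hsum2z : forall m, (0 < m)%N -> `|hsum2 m - z| <= 5 / m%:R.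

Let hsum2z' m : (0 < m)%N -> `|m%:R * (hsum2 m - z)| <= 5.
Proof.
move=> m0; rewrite normrM ger0_norm// mulrC -ler_pdivlMr ?ltr0n//.
exact: hsum2z.
Qed.

(** The coefficients grow like m^3 times a polynomial in [hsum m], beyond the reach of the exact
    sums. One summation by parts replaces m * q m by (n + m) / 2 times the increment of q, whose
    leading part p is m times a quadratic in [hsum m]. The term n * p / 2 is then summed exactly;
    with [hsum2 N] close to z, its constant is k0 / 2 - 6 + z = 16 / 3 - z / 3. *)
Lemma bridge_mean2 :
  `|ratio_sum N (cumsum (cumsum (bridge_coef hsum))) -
    n ^+ 2 * (h ^+ 2 - 4 * h + 16 / 3 - z / 3)| <= 800 * (n * s * h ^+ 2).
Proof.
pose k0 := 68 / 3 - 8 / 3 * z.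
(* [m * q m] is the cubic part of [cumsum2_bridge_coef] with [hsum2 m] replaced by z, and [p] is the
   formal derivative of [q] when 1/m is taken as the derivative of [hsum]. *)
pose q m : R := m%:R ^+ 2 * (8 * hsum m ^+ 2 - 24 * hsum m + k0).
pose p m : R := m%:R * (16 * hsum m ^+ 2 - 32 * hsum m + (2 * k0 - 24)).
set c := cumsum _.
have k0b : 14 <= k0 <= 23 by rewrite /k0; move: z03; lra.
have E1 m : (0 < m <= N)%N ->
    `|c m - m%:R * q m| <= 400 * (m%:R ^+ 2 * hsum m ^+ 2).
  case/andP => m0 _; rewrite /c cumsum2_bridge_coef /q /k0.
  have := hsum2z' m0; have := hsum2_le2 R m; have := hsum2_ge0 R m; have := hsum_ge1 R m0.
  have : 1 <= m%:R :> R by rewrite ler1n.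
  move: (m%:R : R) (hsum m) (hsum2 m) => x y w x1 y1 w0 w2.
  rewrite ler_norml => /andP[d1 d2].
  have a1 : x <= x * x by nra.
  have a2 : y <= y * y by nra.
  have b1 : x * x * 1 <= x * x * (y * y) by apply: ler_wpM2l; nra.
  have b2 : x * x * y <= x * x * (y * y) by apply: ler_wpM2l; nra.
  have b3 : x * (y * y) <= x * x * (y * y) by apply: ler_wpM2r; nra.
  have b4 : x * y <= x * x * (y * y) by apply: ler_pM; nra.
  have b5 : x * x * w <= x * x * 2 by apply: ler_wpM2l; nra.
  have b6 : x * w <= x * 2 by apply: ler_wpM2l; nra.
  have b7 : 1 * (y * y) <= x * (y * y) by apply: ler_wpM2r; nra.
  have c5 : 0 <= x * (y * y) by rewrite !mulr_ge0//; lra.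
  have c1 : 0 <= x * x * w by rewrite !mulr_ge0//; lra.
  have c2 : 0 <= x * w by rewrite !mulr_ge0//; lra.
  have c3 : 0 <= x * x * y by rewrite !mulr_ge0//; lra.
  have c4 : 0 <= x * y by rewrite !mulr_ge0//; lra.
  have e1 : x * x * (x * (w - z)) <= x * x * 5 by apply: ler_wpM2l; nra.
  have e2 : x * x * (- 5) <= x * x * (x * (w - z)) by apply: ler_wpM2l; nra.
  rewrite ler_norml; apply/andP; split; lra.
have E2 m : (0 < m <= N)%N ->
    `|q m - q m.-1 - p m| <= 250 * (1 * hsum m ^+ 2).
  case/andP => m0 _; rewrite mul1r.
  have e : hsum m.-1 = hsum m - m%:R^-1 by case: m m0 => // m _ /=; rewrite hsumS addrK.
  have e' : m.-1%:R = m%:R - 1 :> R by case: m m0 {e} => // m _ /=; rewrite -natr1 addrK.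
  rewrite /q /p e e' {e e'}; have := hsum_ge1 R m0.
  have : 1 <= m%:R :> R by rewrite ler1n.
  move: (m%:R : R) (hsum m) => x y x1 y1.
  have i0 : 0 < x^-1 by rewrite invr_gt0; lra.
  have i1 : x^-1 <= 1 by rewrite invf_le1//; lra.
  have x0 : x != 0 by rewrite gt_eqF//; lra.
  rewrite (_ : _ - _ - _ = 40 - 8 * x^-1 - 8 * y - 8 * (y * y) + 16 * (y * x^-1) -
     8 * (x^-1 * x^-1) - k0); last by field.
  move: (x^-1) i0 i1 => i i0 i1.
  have a1 : 0 <= y * i by rewrite mulr_ge0//; lra.
  have a2 : y * i <= y * 1 by apply: ler_wpM2l; lra.
  have a3 : 0 <= i * i by rewrite mulr_ge0//; lra.
  have a4 : i * i <= 1 * 1 by apply: ler_pM; lra.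
  have a5 : y <= y * y by nra.
  rewrite expr2 ler_norml; move: k0b => /andP[? ?]; apply/andP; split; lra.
have E3 m : (0 < m <= N)%N ->
    `|m%:R * (q m - q m.-1)| <= 400 * (m%:R ^+ 2 * hsum m ^+ 2).
  move=> mN; have := E2 m mN; case/andP: mN => m0 _; rewrite /p.
  have := hsum_ge1 R m0.
  have : 1 <= m%:R :> R by rewrite ler1n.
  move: (m%:R : R) (hsum m) (q m - q m.-1) => x y d x1 y1 hd.
  rewrite normrM ger0_norm; last by lra.
  rewrite [400 * _](_ : _ = x * (400 * (x * (y * y)))); last by ring.
  apply: ler_wpM2l; first by lra.
  have a1 : y <= y * y by nra.
  have a2 : x * 1 <= x * (y * y) by apply: ler_wpM2l; nra.
  have a3 : x * y <= x * (y * y) by apply: ler_wpM2l; lra.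
  have a4 : 1 * (y * y) <= x * (y * y) by apply: ler_wpM2r; nra.
  have a5 : 0 <= x * y by rewrite mulr_ge0//; lra.
  have a6 : x * k0 <= x * 23 by apply: ler_wpM2l; move: k0b; lra.
  have a7 : x * 14 <= x * k0 by apply: ler_wpM2l; move: k0b; lra.
  move: hd; rewrite !ler_norml => /andP[? ?]; apply/andP; split; lra.
have B1 := @ratio_sum_bound _ _ _ _ _ E1 _; have B2 := @ratio_sum_bound _ _ _ _ _ E2 _.
have B3 := @ratio_sum_bound _ _ _ _ _ E3 _.
have {}B1 := B1 (ler0n _ _) (fun m => exprn_ge0 2 (ler0n R m)).
have {}B2 := B2 (ler0n _ _) (fun=> ler01).
have {}B3 := B3 (ler0n _ _) (fun m => exprn_ge0 2 (ler0n R m)).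
have q0 : q 0%N = 0 by rewrite /q expr0n mul0r.
have D : ratio_sum N c = ratio_sum N (fun m => c m - m%:R * q m) +
    2^-1 * (n * ratio_sum N p + (n * ratio_sum N (fun m => q m - q m.-1 - p m) +
       ratio_sum N (fun m => m%:R * (q m - q m.-1)))).
  rewrite -!(ratio_sumZ N n) -!ratio_sumD.
  transitivity (ratio_sum N (fun m => c m - m%:R * q m) +
      ratio_sum N (fun m => m%:R * q m)).
    by rewrite -ratio_sumD; apply: eq_ratio_sum => m _; rewrite subrK.
  rewrite (ratio_sum_parts _ q0); congr (_ + _ * _).
  by apply: eq_ratio_sum => m _; rewrite -/n; ring.
have P : ratio_sum N p = 16 * (n * (h ^+ 2 + hsum2 N) / 8 + ratio_sum N hsum - h / 4) -
    32 * (n * h / 4 + ratio_sum N (fun=> 1) / 2) + (2 * k0 - 24) * (n / 2).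
  rewrite (@eq_ratio_sum _ _ _ (fun m => 16 * (m%:R * hsum m ^+ 2) +
     ((- 32) * (m%:R * hsum m) + (2 * k0 - 24) * m%:R))).
    rewrite !ratio_sumD !ratio_sumZ ratio_sum_mhsumsqr ratio_sum_mhsum ratio_sum_id.
    by rewrite -/n -/h; ring.
  by move=> m _; rewrite /p; ring.
rewrite D P; move: B1 B2 B3 (hsum2z' N0) ratio_sum_hsum_bound S0 Ss ratio_sum_sqr_le.
rewrite -/n /k0 {D P E1 E2 E3 q0 k0b}.
move: (ratio_sum N (fun m => c m - _)) (ratio_sum N (fun m => q m - _ - _)) => X1 X2.
move: (ratio_sum N (fun m => _ * (q m - _))) (ratio_sum N hsum) => X3 X4.
move: (ratio_sum N (fun=> 1)) (ratio_sum N (fun m => m%:R ^+ 2)) => X5 X6.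
move: (hsum2 N) => w; move: n1 s1 h1; move: (n) (s) (h) => j t g j1 t1 g1.
move=> B1 B2 B3 wz /andP[x40 x4] x50 x5 x6.
have g2 : g <= g ^+ 2 by rewrite expr2; nra.
have {}B1 : `|X1| <= 400 * (j * t * g ^+ 2).
  by apply: le_trans B1 (ler_wpM2l (ler0n _ _) (ler_wpM2r (sqr_ge0 _) x6)).
have {}B3 : `|X3| <= 400 * (j * t * g ^+ 2).
  by apply: le_trans B3 (ler_wpM2l (ler0n _ _) (ler_wpM2r (sqr_ge0 _) x6)).
have {}B2 : `|j * X2| <= 250 * (j * t * g ^+ 2).
  rewrite normrM ger0_norm; last by lra.
  rewrite [250 * _](_ : _ = j * (250 * (t * g ^+ 2))); last by ring.
  apply: ler_wpM2l; first by lra.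
  by apply: le_trans B2 (ler_wpM2l (ler0n _ _) (ler_wpM2r (sqr_ge0 _) x5)).
have b4 : j * X4 <= j * (t * g) by apply: ler_wpM2l; lra.
have b40 : 0 <= j * X4 by rewrite mulr_ge0//; lra.
have b5 : j * X5 <= j * t by apply: ler_wpM2l; lra.
have b50 : 0 <= j * X5 by rewrite mulr_ge0//; lra.
have jt : 0 <= j * t by rewrite mulr_ge0//; lra.
have c1 : j * t * g <= j * t * g ^+ 2 by rewrite ler_wpM2l.
have c2 : j * t * 1 <= j * t * g by rewrite ler_wpM2l.
have c3 : j * g * 1 <= j * g * t by rewrite ler_wpM2l// mulr_ge0//; lra.
have c4 : j * 1 <= j * t by rewrite ler_wpM2l//; lra.
have c5 : 0 <= j * g by rewrite mulr_ge0//; lra.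
have d1 : j * (j * (w - z)) <= j * 5.
  by apply: ler_wpM2l; [lra|move: wz; rewrite ler_norml => /andP[]].
have d2 : j * (- 5) <= j * (j * (w - z)).
  by apply: ler_wpM2l; [lra|move: wz; rewrite ler_norml => /andP[]].
move: B1 B2 B3; rewrite !ler_norml => /andP[? ?] /andP[? ?] /andP[? ?].
apply/andP; split; lra.
Qed.

(** In [excursion_coef] the terms of order m * hsum m cancel, which leaves m * (8 * hsum m ^+ 2 - 16
    + 8 * z) up to O(hsum m ^+ 2). No further summation by parts is needed: z comes once from
    [hsum2 N] and four times from the linear sum, hence 5 * z - 8. *)
Lemma excursion_mean2 :
  `|(n + 1) * ratio_sum N (excursion_coef hsum) -
    n ^+ 2 * (h ^+ 2 + 5 * z - 8)| <= 300 * (n * s * h ^+ 2).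
Proof.
pose p m : R := m%:R * (8 * hsum m ^+ 2 - 16 + 8 * z).
have E1 m : (0 < m <= N)%N ->
    `|excursion_coef hsum m - p m| <= 70 * (1 * hsum m ^+ 2).
  case/andP => m0 _; rewrite mul1r excursion_coef_hsum// /p.
  have := hsum2z' m0; have := hsum_ge1 R m0.
  have : 1 <= m%:R :> R by rewrite ler1n.
  move: (m%:R : R) (hsum m) (hsum2 m) => x y w x1 y1.
  have i0 : 0 < x^-1 by rewrite invr_gt0; lra.
  have i1 : x^-1 <= 1 by rewrite invf_le1//; lra.
  have x0 : x != 0 by rewrite gt_eqF//; lra.
  rewrite [X in _ -> is_true (`|X| <= _)](_ : _ = 8 * (x * (w - z)) - 8 * y +
    8 * (y * x^-1) - 4 * (x^-1 * x^-1) + 8); last by field.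
  move: (x^-1) i0 i1 => i i0 i1.
  have a1 : 0 <= y * i by rewrite mulr_ge0//; lra.
  have a2 : y * i <= y * 1 by apply: ler_wpM2l; lra.
  have a3 : 0 <= i * i by rewrite mulr_ge0//; lra.
  have a4 : i * i <= 1 * 1 by apply: ler_pM; lra.
  have a5 : y <= y * y by nra.
  rewrite expr2 !ler_norml => /andP[? ?]; apply/andP; split; lra.
have B1 := @ratio_sum_bound _ _ _ _ _ E1 _.
have {}B1 := B1 (ler0n _ _) (fun=> ler01).
have D : ratio_sum N (excursion_coef hsum) =
    ratio_sum N (fun m => excursion_coef hsum m - p m) +
    (8 * (n * (h ^+ 2 + hsum2 N) / 8 + ratio_sum N hsum - h / 4) + (8 * z - 16) * (n / 2)).
  rewrite -ratio_sum_mhsumsqr -ratio_sum_id -!ratio_sumZ -!ratio_sumD.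
  by apply: eq_ratio_sum => m _; rewrite /p; ring.
rewrite D; move: B1 (hsum2z' N0) ratio_sum_hsum_bound S0 Ss; rewrite -/n {D E1}.
move: (ratio_sum N (fun m => _ - p m)) (ratio_sum N hsum) => X1 X4.
move: (ratio_sum N (fun=> 1)) => X5.
move: (hsum2 N) => w; move: n1 s1 h1; move: (n) (s) (h) => j t g j1 t1 g1.
move=> B1 wz /andP[x40 x4] x50 x5.
have g2 : g <= g ^+ 2 by rewrite expr2; nra.
have {}B1 : `|X1| <= 70 * (t * g ^+ 2).
  by apply: le_trans B1 (ler_wpM2l (ler0n _ _) (ler_wpM2r (sqr_ge0 _) x5)).
pose Y := X1 + (8 * X4 - 2 * g) + j * (w - z).
have YB : `|Y| <= 90 * (t * g ^+ 2).
  have c1 : t * g <= t * g ^+ 2 by rewrite ler_wpM2l//; lra.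
  have c2 : 1 * g <= t * g by rewrite ler_wpM2r//; lra.
  move: B1 wz; rewrite /Y !ler_norml => /andP[? ?] /andP[? ?].
  by apply/andP; split; lra.
rewrite [X in `|X|](_ : _ = (j + 1) * Y + j * (g ^+ 2 + 5 * z - 8)); last first.
  by rewrite /Y; field.
apply: le_trans (ler_normD _ _) _; rewrite !normrM [`|j + 1|]ger0_norm; last by lra.
rewrite [`|j|]ger0_norm; last by lra.
have K1 : (j + 1) * `|Y| <= (2 * j) * (90 * (t * g ^+ 2)).
  by apply: ler_pM => //; lra.
have gt : g ^+ 2 <= t * g ^+ 2 by rewrite ler_peMl// sqr_ge0.
have K2 : j * `|g ^+ 2 + 5 * z - 8| <= j * (19 * (t * g ^+ 2)).
  apply: ler_wpM2l; first by lra.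
  by move: z03 => /andP[? ?]; rewrite ler_norml; apply/andP; split; nra.
have K3 : 0 <= j * (t * g ^+ 2) by rewrite !mulr_ge0 ?sqr_ge0//; lra.
apply: le_trans (lerD K1 K2) _; lra.
Qed.

End Estimates.
End RatioSumAsymptotics.

(** * The Basel sum and the Euler constant *)

Section Basel.
Variable R : realType.
Local Notation hsum := (@hsum R).
Local Notation hsum2 := (@hsum2 R).

Lemma sin_le_id (x : R) : 0 < x -> sin x <= x.
Proof.
move=> x0; have d y : y \in `]0, x[ -> is_derive y 1 sin (cos y) by move=> _; exact: is_derive_sin.
have c : {within `[0, x], continuous (@sin R)}.
  by apply: derivable_within_continuous => y _; exact: derivable_sin.
have [c' _] := MVT x0 d c.
rewrite sin0 !subr0 => ->.
by rewrite ler_piMl ?cos_le1// ltW.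
Qed.

Lemma id_le_tan (x : R) : 0 < x < pi / 2 -> x <= tan x.
Proof.
move=> /andP[x0 xpi].
have cx y : 0 <= y -> y <= x -> 0 < cos y.
  move=> y0 yx; apply: cos_gt0_pihalf; rewrite (le_lt_trans yx)// andbT.
  by rewrite (@lt_le_trans _ _ 0)// oppr_lt0 divr_gt0 ?pi_gt0.
have d y : y \in `]0, x[ -> is_derive y 1 tan ((cos y) ^- 2).
  rewrite in_itv/= => /andP[y0 yx].
  by apply: is_derive_tan; rewrite gt_eqF// cx// ltW.
have c : {within `[0, x], continuous (@tan R)}.
  apply: derivable_within_continuous => y; rewrite in_itv/= => /andP[y0 yx].
  by apply: derivable_tan; rewrite gt_eqF// cx.
have [c'] := MVT x0 d c; rewrite in_itv/= => /andP[c0 c1]; rewrite tan0 !subr0 => ->.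
have k0 : 0 < cos c' by rewrite cx// ltW.
have k1 : cos c' ^+ 2 <= 1 by rewrite expr_le1 ?cos_le1// ltW.
by rewrite ler_peMl ?(ltW x0)// invf_ge1// exprn_gt0.
Qed.

(** From sin x <= x <= tan x, since 1 / sin^2 = 1 / tan^2 + 1. *)
Lemma sin_inv_sqr (x : R) : 0 < x < pi / 2 ->
  x ^- 2 <= (sin x) ^- 2 <= x ^- 2 + 1.
Proof.
move=> xb; have /andP[x0 xpi] := xb.
have s0 : 0 < sin x by apply: sin_gt0_pihalf.
have c0 : 0 < cos x.
  by apply: cos_gt0_pihalf; rewrite xpi andbT (@lt_trans _ _ 0)// oppr_lt0 divr_gt0 ?pi_gt0.
have := sin_le_id x0; have := id_le_tan xb; rewrite /tan ler_pdivlMr// => xt sx.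
apply/andP; split.
  by rewrite lef_pV2 ?posrE ?exprn_gt0// lerXn2r ?nnegrE// ltW.
have e := cos2Dsin2 x.
have -> : (sin x) ^- 2 = (cos x) ^+ 2 / (sin x) ^+ 2 + 1.
  by rewrite -[X in _ + X](@divff _ (sin x ^+ 2)) ?expf_neq0 ?gt_eqF// -mulrDl e mul1r.
rewrite lerD2r ler_pdivrMr ?exprn_gt0// mulrC ler_pdivlMr ?exprn_gt0//.
by rewrite -exprMn lerXn2r ?nnegrE ?mulr_ge0 ?(ltW s0) ?(ltW c0) ?(ltW x0)// mulrC.
Qed.

Lemma sin_inv_sqr_half (x : R) : 0 < x < pi / 2 ->
  (sin x) ^- 2 = ((sin (x / 2)) ^- 2 + (sin (pi / 2 - x / 2)) ^- 2) / 4.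
Proof.
move=> /andP[x0 xpi].
have s0 : 0 < sin (x / 2) by apply: sin_gt0_pihalf; move: xpi; rewrite divr_gt0//=; lra.
have c0 : 0 < cos (x / 2) by apply: cos_gt0_pihalf; apply/andP; split; move: (pi_gt0 R); lra.
have -> : sin (pi / 2 - x / 2) = cos (x / 2).
  by rewrite sinB sin_pihalf cos_pihalf; ring.
have {1}-> : x = (x / 2) *+ 2 by rewrite mulr2n; field.
rewrite sin_mulr2n -mulr_natr.
have e := cos2Dsin2 (x / 2).
move: (sin (x / 2)) (cos (x / 2)) s0 c0 e => s c s0 c0 e.
transitivity ((c ^+ 2 + s ^+ 2) * (c * s * 2) ^- 2); first by rewrite e mul1r.
by field; rewrite !gt_eqF.
Qed.

Let angle (n k : nat) : R := (k.*2.+1)%:R * pi / (2 ^ n.+2)%:R.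

Let pow_gt0 n : 0 < (2 ^ n)%:R :> R.
Proof. by rewrite ltr0n expn_gt0. Qed.

Let angle_bound n k : (k < 2 ^ n)%N -> 0 < angle n k < pi / 2.
Proof.
move=> kn; rewrite /angle divr_gt0 ?mulr_gt0 ?pi_gt0//=.
have H : (k.*2.+1 * 2 < 2 ^ n.+2)%N by rewrite !expnS; lia.
rewrite ltr_pdivrMr// [ltRHS](_ : _ = (2 ^ n.+2)%:R / 2 * pi); last by ring.
by rewrite ltr_pM2r ?pi_gt0// ltr_pdivlMr// -natrM ltr_nat.
Qed.

(** By [sin_inv_sqr_half] the total is multiplied by 4 at each step: the halves x / 2 are the first
    2^n angles of the next family, and the complements pi / 2 - x / 2 are the others in reverse
    order. The initial value 2 is 1 / sin^2 (pi / 4). *)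
Lemma sum_sin_inv_sqr n :
  \sum_(k < 2 ^ n) (sin (angle n k)) ^- 2 = 2 * 4 ^+ n :> R.
Proof.
elim: n => [|n IH].
  rewrite big_ord1 /angle mul1r expr0 mulr1.
  have sq0 : 0 < (pi / 4 : R) < pi / 2 by move: (pi_gt0 R) => ?; apply/andP; split; lra.
  have := tan_piquarter R; rewrite /tan => /(congr1 ( *%R^~ (cos (pi / 4)))).
  rewrite mul1r divfK; last first.
    by rewrite gt_eqF// cos_gt0_pihalf//; move: (pi_gt0 R) => ?; apply/andP; split; lra.
  move=> sc; have := cos2Dsin2 (pi / 4 : R); rewrite -sc.
  have s0 := sin_gt0_pihalf sq0; move: (sin _) s0 => s s0 e.
  have -> : s ^+ 2 = 2^-1 by lra.
  by rewrite invrK.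
have -> : 2 * 4 ^+ n.+1 = 4 * \sum_(k < 2 ^ n) (sin (angle n k)) ^- 2 :> R.
  by rewrite IH exprS; ring.
rewrite mulr_sumr.
under [RHS]eq_bigr => k _ do rewrite (sin_inv_sqr_half (angle_bound (ltn_ord k))) mulrCA divff// mulr1.
rewrite big_split/= -(big_mkord predT (fun k => sin (angle n.+1 k) ^- 2)).
have l : (2 ^ n <= 2 ^ n.+1)%N by rewrite leq_exp2l.
have e2 : (2 ^ n.+1 = 2 ^ n + 2 ^ n)%N by rewrite expnS mul2n addnn.
rewrite (big_cat_nat (leq0n _) l)/= e2 -{2}[(2 ^ n)%N]add0n big_addn addnK !big_mkord.
have pn0 := lt0r_neq0 (pow_gt0 n.+2).
have pnS : (2 ^ n.+3)%:R = 2 * (2 ^ n.+2)%:R :> R by rewrite expnS natrM.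
congr (_ + _).
  apply: eq_bigr => k _; congr (sin _ ^- 2).
  by rewrite /angle pnS; move: pn0; move: (2 ^ _)%:R => p p0; field.
rewrite (reindex_inj rev_ord_inj)/=; apply: eq_bigr => k _; congr (sin _ ^- 2).
rewrite /angle pnS.
have -> : (((2 ^ n - k.+1) + 2 ^ n).*2.+1)%:R = (2 ^ n.+2)%:R - k.*2.+1%:R :> R.
  rewrite -natrB; last by rewrite !expnS; have := ltn_ord k; lia.
  by congr (_%:R); rewrite !expnS; have := ltn_ord k; lia.
by move: pn0; move: (2 ^ _)%:R => p p0; field.
Qed.

Let odd_sum n : R := \sum_(k < n) (k.*2.+1%:R ^+ 2)^-1.

Lemma hsum2_double n : hsum2 n.*2 = odd_sum n + hsum2 n / 4.
Proof.
elim: n => [|n IH]; first by rewrite /odd_sum big_ord0 hsum2_0; ring.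
rewrite doubleS !hsum2S IH /odd_sum big_ord_recr/=.
have -> : n.*2.+2%:R = 2 * n.+1%:R :> R by rewrite -natrM mul2n doubleS.
by field; rewrite !add1n_neq0.
Qed.

(** Each 1 / (2k + 1)^2 is pi^2 / (16 * 4^n) times an inverse squared angle. Passing to the inverse
    squared sine costs at most 1 for each of the 2^n angles, against the exact total 2 * 4^n. *)
Lemma odd_sum_bound n : pi ^+ 2 / 8 * (1 - (2 ^ n.+1)%:R^-1) <= odd_sum (2 ^ n) <= pi ^+ 2 / 8.
Proof.
have p0 := lt0r_neq0 (pow_gt0 n).
have pi0 := lt0r_neq0 (pi_gt0 R).
have E k : (k.*2.+1%:R ^+ 2)^-1 = pi ^+ 2 / (16 * (2 ^ n)%:R ^+ 2) * (angle n k) ^- 2 :> R.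
  rewrite /angle !expnS !natrM; have k0 : k.*2.+1%:R != 0 :> R by rewrite pnatr_eq0.
  by move: p0 k0 pi0; move: (2 ^ n)%:R (k.*2.+1%:R) (pi : R) => x y z x0 y0 z0; field; rewrite x0 y0 z0.
have e4 : 4 ^+ n = (2 ^ n)%:R ^+ 2 :> R.
  by rewrite -!natrX -expnM mulnC expnM.
have S := sum_sin_inv_sqr n; rewrite e4 in S.
have c0 : 0 <= pi ^+ 2 / (16 * (2 ^ n)%:R ^+ 2) :> R by rewrite divr_ge0 ?sqr_ge0// mulr_ge0 ?sqr_ge0.
rewrite /odd_sum (eq_bigr _ (fun k _ => E (nat_of_ord k))) -mulr_sumr.
have U : \sum_(k < 2 ^ n) (angle n k) ^- 2 <= 2 * (2 ^ n)%:R ^+ 2.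
  rewrite -S; apply: ler_sum => k _.
  by have /andP[] := sin_inv_sqr (angle_bound (ltn_ord k)).
have L : 2 * (2 ^ n)%:R ^+ 2 - (2 ^ n)%:R <= \sum_(k < 2 ^ n) (angle n k) ^- 2.
  rewrite lerBlDr -S.
  have -> : (2 ^ n)%:R = \sum_(k < 2 ^ n) 1 :> R by rewrite sumr_const card_ord.
  rewrite -big_split/=; apply: ler_sum => k _.
  by have /andP[] := sin_inv_sqr (angle_bound (ltn_ord k)).
apply/andP; split.
  apply: le_trans (ler_wpM2l c0 L); rewrite expnS natrM le_eqVlt; apply/orP; left.
  by apply/eqP; move: p0; move: (2 ^ n)%:R (pi : R) => x y x0; field.
apply: le_trans (ler_wpM2l c0 U) _; rewrite le_eqVlt; apply/orP; left.
by apply/eqP; move: p0; move: (2 ^ n)%:R (pi : R) => x y x0; field.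
Qed.

Lemma hsum2_tail m n : (0 < m)%N -> 0 <= hsum2 (n + m) - hsum2 m <= m%:R^-1.
Proof.
move=> m0; suff: 0 <= hsum2 (n + m) - hsum2 m <= m%:R^-1 - (n + m)%:R^-1.
  case/andP => -> /le_trans -> //=; by rewrite gerBl invr_ge0.
elim: n => [|n IH]; first by rewrite add0n !subrr lexx.
have k0 : 0 < (n + m)%:R :> R by rewrite ltr0n addn_gt0 m0 orbT.
rewrite addSn hsum2S -natr1; move: IH k0.
move: (hsum2 _) (hsum2 _) (m%:R^-1) ((n + m)%:R) => x y z k /andP[h1 h2] k0.
have k1 : 0 < k + 1 by lra.
have p : 0 < (k + 1) ^- 2 by rewrite invr_gt0 exprn_gt0.
have q : k^-1 - (k + 1)^-1 = (k + 1) ^- 2 + (k * (k + 1) ^+ 2)^-1.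
  by field; rewrite !gt_eqF.
have r : 0 < (k * (k + 1) ^+ 2)^-1 by rewrite invr_gt0 mulr_gt0 ?exprn_gt0.
apply/andP; split; lra.
Qed.

(** The odd sum is controlled only at powers of two, so m is compared with n = 2^m, which costs at
    most 1/m. As hsum2 (2n) and hsum2 n differ by at most 1/n, the odd sum is nearly 3/4 of hsum2 n,
    and pi^2 / 8 turns into pi^2 / 6. *)
Lemma hsum2_pi m : (0 < m)%N -> `|hsum2 m - pi ^+ 2 / 6| <= 5 / m%:R.
Proof.
move=> m0; set n := (2 ^ m)%N.
have mn : (m <= n)%N by rewrite ltnW// ltn_expl.
have n0 : (0 < n)%N by rewrite expn_gt0.
have mi : n%:R^-1 <= m%:R^-1 :> R by rewrite lef_pV2 ?posrE ?ltr0n// ler_nat.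
have ni : 0 < n%:R^-1 :> R by rewrite invr_gt0 ltr0n.
have T1 := hsum2_tail (n - m) m0; rewrite subnK// in T1.
have T2 := hsum2_tail n n0; rewrite addnn hsum2_double in T2.
have := odd_sum_bound m; rewrite -/n expnS natrM invfM -/n => O.
have pi4 : pi < 4 :> R by have := pihalf_lt2 R; lra.
have pi2 : 0 <= (pi ^+ 2 : R) <= 16.
  by rewrite sqr_ge0 /=; have := pi_gt0 R; move: pi4; move: (pi : R) => x; nra.
have pn : pi ^+ 2 * n%:R^-1 <= 16 * n%:R^-1 :> R.
  by apply: ler_wpM2r; [exact: ltW|case/andP: pi2].
rewrite -[5 / _]/(5 * m%:R^-1).
move: T1 T2 O pi2 pn mi ni; move: (hsum2 m) (hsum2 n) (odd_sum n) (pi ^+ 2 : R) (m%:R^-1) (n%:R^-1).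
move=> x y o p i j /andP[? ?] /andP[? ?] /andP[? ?] /andP[? ?] ? ? ?.
by rewrite ler_norml; apply/andP; split; lra.
Qed.

(** The sequence hsum m - ln m decreases and hsum m - ln m - 1/m increases; both tend to
    [euler_gamma], which they enclose. *)
Lemma hsum_ln n : (0 < n)%N -> 0 <= hsum n - ln n%:R - euler_gamma <= n%:R^-1.
Proof.
have lnr (m : nat) : (0 < m)%N ->
    m.+1%:R^-1 <= ln m.+1%:R - ln m%:R :> R /\ ln m.+1%:R - ln m%:R <= m%:R^-1 :> R.
  move=> m0; have p : 0 < m%:R :> R by rewrite ltr0n.
  have p1 : 0 < m.+1%:R :> R by rewrite ltr0n.
  split.
    have : ln (1 + - m.+1%:R^-1) <= - m.+1%:R^-1 :> R.
      by apply: le_ln1Dx; rewrite ltrN2 invf_lt1// ltr1n.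
    have -> : 1 + - m.+1%:R^-1 = m%:R / m.+1%:R :> R.
      by rewrite -[m.+1]addn1 natrD; field; rewrite natr1 pnatr_eq0.
    by rewrite ln_div ?posrE//; move: (ln _) (ln _) (_^-1) => a b c; lra.
  have : ln (1 + m%:R^-1) <= m%:R^-1 :> R.
    by apply: le_ln1Dx; rewrite (lt_trans (y := 0))// ?ltrN10// invr_gt0.
  have -> : 1 + m%:R^-1 = m.+1%:R / m%:R :> R.
    by rewrite -[m.+1]addn1 natrD; field; rewrite gt_eqF.
  by rewrite ln_div ?posrE.
move=> n0; pose u m : R := hsum m - ln m%:R.
have uk k : u (k + n)%N <= u n /\ u n - n%:R^-1 <= u (k + n)%N - (k + n)%:R^-1.
  elim: k => [|k [Ihsum Ihsum2]]; first by rewrite add0n.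
  have kn : (0 < k + n)%N by rewrite addn_gt0 n0 orbT.
  have [] := lnr _ kn; rewrite addSn; move: Ihsum Ihsum2; rewrite /u hsumS.
  move: (hsum _) (hsum _) (ln _) (ln _) (ln _) (_^-1) (_^-1) (_^-1) => i j a b c d e f *; split; lra.
have near_ge (P : nat -> Prop) : (forall k, P (k + n)%N) -> \forall m \near \oo, P m.
  by move=> HP; exists n => // m /= nm; rewrite -(subnK nm); exact: HP.
have cv := @cvg_euler_gamma R.
have E : euler_gamma = lim (u @ \oo) by [].
apply/andP; split.
  rewrite subr_ge0 E; apply: limr_le; first exact: cvgP cv.
  by apply: near_ge => k; have [] := uk k.
rewrite lerBlDr -lerBlDl E; apply: limr_ge; first exact: cvgP cv.
apply: near_ge => k; have [_ h] := uk k; apply: le_trans h _.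
by rewrite gerBl invr_ge0.
Qed.

End Basel.

(** * Means over bridges and paths *)

Section MeansAsRatioSums.
Variable R : realType.
Local Notation W := (@walk_kernel R).
Local Notation r := (@central_ratio R).

Lemma walk_kernel_ratio N m : W (2 * N) m.*2 = W (2 * N) 0 * r N m.
Proof.
elim: m => [|m IH]; first by rewrite mulr1.
case: (ltnP m N) => mN; last first.
  by rewrite central_ratio_gt// mulr0 (proj1 (step_walk_kernel R))//; lia.
have k0 : N%:R + m%:R + 1 != 0 :> R by rewrite -natrD natr1 pnatr_eq0.
apply: (mulfI k0); rewrite mulrCA central_ratio_rec mulrCA -IH /walk_kernel.
have E j : (j <= N)%N -> walks (2 * N) j.*2 = 'C(2 * N, N - j).
  by move=> jN; rewrite (_ : 2 * N = j.*2 + (N - j).*2)%N ?walks_bin//; lia.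
rewrite !E ?(ltnW mN)// -natrB ?(ltnW mN)// -!natrD natr1 -!natrM; congr (_%:R).
have -> : (N - m = (N - m.+1).+1)%N by lia.
by rewrite [RHS]mul_bin_left; congr muln; lia.
Qed.

Lemma walk_kernel_gt0 N : 0 < W (2 * N) 0.
Proof.
rewrite /walk_kernel ltr0n (_ : 2 * N = 0 + N.*2)%N ?walks_bin ?bin_gt0; lia.
Qed.

Lemma sum_walk_kernel N (c : nat -> R) : c 0%N = 0 ->
  \sum_(j < (2 * N).+1) c j * W (2 * N) j.*2 = W (2 * N) 0 * ratio_sum N c.
Proof.
move=> c0; rewrite big_ord_recl/= c0 mul0r add0r.
rewrite (@ratio_sum_widen _ _ _ (2 * N)); last by lia.
by rewrite mulr_sumr; apply: eq_bigr => j _; rewrite /bump/= add1n walk_kernel_ratio; ring.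
Qed.

Lemma mem_dyck_bridges N (s : sign_seq N) : (s \in dyck_bridges N) = ends_at0 0 s.
Proof. by rewrite inE /ends_at0 add0r. Qed.

Lemma mem_dyck_paths N (s : sign_seq N) :
  (s \in dyck_paths N) = ends_at0 0 s && stays_ge0 0 s.
Proof.
rewrite inE mem_dyck_bridges; congr (_ && _); apply: eq_forallb => j.
by rewrite add0r.
Qed.

(** The half-integer height is the midpoint of a step, so |h| + 1/2 is the absolute value of the
    endpoint farther from 0. *)
Lemma hbarE N (s : sign_seq N) i :
  hbar R s i = (edge_level (position 0 s i) (s i))%:R.
Proof.
rewrite /hbar /height; set x : int := \sum_(j < 2 * N | _) _.
have -> : position 0 s i = x by rewrite /position add0r.
have up (k : nat) : `|k%:R + 1 / 2| + 2^-1 = k.+1%:R :> R.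
  by rewrite ger0_norm ?addr_ge0// -[k.+1]addn1 natrD; field.
have dn (k : nat) : `|k.+1%:R - 1 / 2| + 2^-1 = k.+1%:R :> R.
  by rewrite -[k.+1]addn1 natrD ger0_norm; [field|have : 0 <= k%:R :> R by []; lra].
have zN (k : nat) : (- k.+1%:Z)%:~R = - k.+1%:R :> R by rewrite rmorphN /= -pmulrn.
have z1 : 1%:~R = 1 :> R by [].
have zN1 : (-1)%:~R = -1 :> R by [].
rewrite /spin; case: (s i); rewrite ?z1 ?zN1; case: (intP x) => [|k|k].
- by rewrite -[0]/(0%N%:Z) edge_level_up -pmulrn up.
- by rewrite edge_level_up -pmulrn up.
- rewrite edge_levelN edge_level_down zN -[RHS]dn.
  by congr (_ + _); rewrite -normrN; congr `|_|; ring.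
- rewrite -[X in edge_level X _]oppr0 edge_levelN -[0]/(0%N%:Z) edge_level_up.
  rewrite -[RHS]up; congr (_ + _); rewrite -normrN; congr `|_|.
  by rewrite -pmulrn; ring.
- by rewrite edge_level_down -pmulrn -[RHS]dn mulN1r mul1r.
- rewrite edge_levelN edge_level_up zN -[RHS]up; congr (_ + _).
  by rewrite -normrN; congr `|_|; ring.
Qed.

Lemma edge_level_gt0 x b : (0 < edge_level x b)%N.
Proof.
rewrite /edge_level leq_max !absz_gt0; case: eqP => //= ->.
by rewrite add0r; case: b.
Qed.

Lemma card_bridges N : #|dyck_bridges N|%:R = W (2 * N) 0.
Proof.
rewrite -(bridge_count (fun=> 0) (2 * N) 0) /bridge_total sumr_const; congr (_%:R).
by apply: eq_card => s; rewrite mem_dyck_bridges.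
Qed.

(** The Catalan number: excursions are counted by W(2N, 0) - W(2N, 2), and r(1) = N / (N + 1). This
    is the origin of the factor N + 1 in all means over paths. *)
Lemma card_paths N : #|dyck_paths N|%:R = W (2 * N) 0 / (N%:R + 1).
Proof.
transitivity (W (2 * N) 0 - W (2 * N) 2).
  rewrite -(excursion_count (fun=> 0) (2 * N) 0) /excursion_total sumr_const; congr (_%:R).
  by apply: eq_card => s; rewrite mem_dyck_paths.
have n1 : N%:R + 1 != 0 :> R by rewrite natr1 pnatr_eq0.
rewrite (walk_kernel_ratio N 1); apply: (mulIf n1); rewrite divfK//.
have := central_ratio_rec R N 0; rewrite addr0 subr0 [r N 0]/central_ratio mulr1.
by move=> e; rewrite mulrBl -mulrA [r N 1 * _]mulrC e; ring.
Qed.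

Section Sums.
Variables (N : nat) (a : nat -> R).
Hypothesis a0 : a 0%N = 0.

Lemma unif_mean_bridges phi :
  unif_mean (dyck_bridges N) (fun s => phi (walk_sum a 0 s)) =
  bridge_total a phi (2 * N) 0 / W (2 * N) 0.
Proof.
rewrite /unif_mean card_bridges; congr (_ / _); apply: eq_bigl => s.
exact: mem_dyck_bridges.
Qed.

Lemma unif_mean_paths phi :
  unif_mean (dyck_paths N) (fun s => phi (walk_sum a 0 s)) =
  (N%:R + 1) * (excursion_total a phi (2 * N) 0 / W (2 * N) 0).
Proof.
rewrite /unif_mean card_paths invf_div mulrCA; congr (_ * (_ / _)).
by apply: eq_bigl => s; exact: mem_dyck_paths.
Qed.

Let K0 : W (2 * N) 0 != 0. Proof. by rewrite gt_eqF// walk_kernel_gt0. Qed.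

Lemma bridges_mean1 : unif_mean (dyck_bridges N) (fun s => walk_sum a 0 s) =
  4 * ratio_sum N (cumsum a).
Proof.
rewrite (unif_mean_bridges id) (bridge_sum_moment1 a0) sum_walk_kernel.
  by rewrite mulrCA mulrAC divff// mul1r.
by rewrite /cumsum big_ord1.
Qed.

Lemma bridges_mean2 : unif_mean (dyck_bridges N) (fun s => walk_sum a 0 s ^+ 2) =
  ratio_sum N (cumsum (cumsum (bridge_coef a))).
Proof.
rewrite (unif_mean_bridges (fun t => t ^+ 2)) (bridge_sum_moment2 a0) sum_walk_kernel.
  by rewrite mulrAC divff// mul1r.
rewrite /cumsum !big_ord1 /bridge_coef /= (square_diff0 a0) /convolution big_ord1 a0.
by ring.
Qed.

Lemma paths_mean1 : unif_mean (dyck_paths N) (fun s => walk_sum a 0 s) =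
  (N%:R + 1) * ratio_sum N (fun m => 2 * (a m - a m.-1)).
Proof.
rewrite (unif_mean_paths id) (excursion_sum_moment1 a0).
rewrite (@sum_walk_kernel N (fun m => 2 * (a m - a m.-1))).
  by rewrite [_ / W _ _]mulrAC divff// mul1r.
by rewrite subrr mulr0.
Qed.

Lemma paths_mean2 : unif_mean (dyck_paths N) (fun s => walk_sum a 0 s ^+ 2) =
  (N%:R + 1) * ratio_sum N (excursion_coef a).
Proof.
rewrite (unif_mean_paths (fun t => t ^+ 2)) (excursion_sum_moment2 a0) sum_walk_kernel.
  by rewrite [_ / W _ _]mulrAC divff// mul1r.
rewrite /excursion_coef /= (square_diff0 a0) /convolution big_ord1 a0.
by ring.
Qed.

End Sums.
End MeansAsRatioSums.

(** * Asymptotics of the entropy *)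

Section UniformMeans.
Variables (R : realType) (T : finType) (A : {set T}).
Hypothesis A0 : (0 < #|A|)%N.
Implicit Types f g : T -> R.

Let cA0 : #|A|%:R != 0 :> R. Proof. by rewrite pnatr_eq0 -lt0n. Qed.

Lemma eq_unif_mean f g : {in A, f =1 g} -> unif_mean A f = unif_mean A g.
Proof. by move=> fg; congr (_ / _); apply: eq_bigr => s /fg. Qed.

Lemma unif_meanD f g : unif_mean A (fun s => f s + g s) = unif_mean A f + unif_mean A g.
Proof. by rewrite /unif_mean big_split mulrDl. Qed.

Lemma unif_meanZ c f : unif_mean A (fun s => c * f s) = c * unif_mean A f.
Proof. by rewrite /unif_mean -mulr_sumr mulrA. Qed.

Lemma unif_mean_cst (c : R) : unif_mean A (fun=> c) = c.
Proof. by rewrite /unif_mean sumr_const -[c *+ _]mulr_natr mulfK. Qed.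

Lemma unif_mean_dist f g e : (forall s, s \in A -> `|f s - g s| <= e s) ->
  `|unif_mean A f - unif_mean A g| <= unif_mean A e.
Proof.
move=> fg; rewrite /unif_mean -mulrBl -sumrB normrM [`|_^-1|]ger0_norm ?invr_ge0//.
rewrite ler_wpM2r ?invr_ge0//; apply: le_trans (ler_norm_sum _ _ _) _.
exact: ler_sum.
Qed.

End UniformMeans.

Section EntropyAsymptotics.
Variable R : realType.
Local Notation hsum := (@hsum R).
Local Notation gamma := (@euler_gamma R).

Lemma gamma_bound : 0 <= gamma <= 1.
Proof.
by have := @hsum_ln R 1 isT; rewrite hsumS hsum_0 ln1 invr1 add0r subr0; lra.
Qed.

Section Pointwise.
Variables (N : nat) (s : sign_seq N).
Hypothesis N0 : (0 < N)%N.
Hypothesis sB : s \in dyck_bridges N.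
Hypothesis l1 : 1 <= ln N%:R :> R.

Let n : R := N%:R.
Let n0 : 0 < n. Proof. by rewrite ltr0n. Qed.
Let X := walk_sum (fun h => ln h%:R : R) 0 s.
Let Y := walk_sum hsum 0 s.
Let I := walk_sum (fun h => h%:R^-1 : R) 0 s.

Let sE : rescaled_entropy R s = X / (2 * n) - ln n / 2.
Proof.
have XE : \sum_(i < 2 * N) ln (hbar R s i) = X by apply: eq_bigr => i _; rewrite hbarE.
by rewrite /rescaled_entropy entropyE// -/n XE; field; rewrite gt_eqF.
Qed.

Let sum2N (c : R) : \sum_(i < 2 * N) c = 2 * n * c.
Proof. by rewrite sumr_const card_ord -[c *+ _]mulr_natl natrM. Qed.

Let XYI : `|X - Y + 2 * n * gamma| <= I.
Proof.
rewrite -sum2N /X /Y /walk_sum -sumrB -big_split/=.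
apply: le_trans (ler_norm_sum _ _ _) _; apply: ler_sum => i _.
have := hsum_ln R (edge_level_gt0 (position 0 s i) (s i)).
move: (edge_level _ _) => h /andP[h1 h2]; rewrite ler_norml.
by apply/andP; split; lra.
Qed.

Let I_bound : 0 <= I <= 2 * n.
Proof.
apply/andP; split; first by apply: sumr_ge0 => i _; rewrite invr_ge0.
rewrite -[leRHS]mulr1 -sum2N; apply: ler_sum => i _.
by rewrite invf_le1 ?ler1n ?ltr0n ?edge_level_gt0.
Qed.

Let X_bound : 0 <= X <= 2 * n * (2 + ln n).
Proof.
apply/andP; split; first by apply: sumr_ge0 => i _; rewrite ln_ge0// ler1n edge_level_gt0.
rewrite -sum2N; apply: ler_sum => i _.
have h := edge_level_le s i; have h0 := edge_level_gt0 (position 0 s i) (s i).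
(* Labels are at most 2N + 1 <= 3N. *)
have l3 : ln 3 <= 2 :> R by have -> : 3 = 1 + 2 :> R; [lra|apply: le_ln1Dx; lra].
apply: (@le_trans _ _ (ln (3 * n))); last by rewrite lnM ?posrE// lerD2r.
by rewrite ler_ln ?posrE ?ltr0n ?mulr_gt0// -natrM ler_nat; lia.
Qed.

Definition harmonic_entropy : R := Y / (2 * n) - (gamma + ln n / 2).

Lemma harmonic_entropy_dist :
  `|rescaled_entropy R s - harmonic_entropy| <= (2 * n)^-1 * I.
Proof.
rewrite sE /harmonic_entropy.
rewrite (_ : _ - _ = (2 * n)^-1 * (X - Y + 2 * n * gamma)); last by field; rewrite gt_eqF.
by rewrite normrM ger0_norm ?invr_ge0 ?mulr_ge0 ?(ltW n0)// ler_wpM2l// invr_ge0 mulr_ge0// ltW.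
Qed.

(** A difference of squares: the sum of the two entropies is at most 2 (ln n / 2 + 2) + 1 in
    absolute value, and ln n + 5 <= 6 ln n because ln n >= 1. *)
Lemma harmonic_entropy_sqr_dist :
  `|rescaled_entropy R s ^+ 2 - harmonic_entropy ^+ 2| <= 6 * ln n / (2 * n) * I.
Proof.
rewrite [leRHS](_ : _ = 6 * ln n * (I / (2 * n))); last by ring.
have := harmonic_entropy_dist; rewrite [_^-1 * I]mulrC.
have nn : 0 < 2 * n by rewrite mulr_gt0.
have e1 : 0 <= I / (2 * n) <= 1.
  by case/andP: I_bound => i0 i1; rewrite divr_ge0 ?(ltW nn)//= ler_pdivrMr// mul1r.
have : `|rescaled_entropy R s| <= ln n / 2 + 2.
  have x1 : 0 <= X / (2 * n) <= 2 + ln n.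
    by case/andP: X_bound => i0 i1; rewrite divr_ge0 ?(ltW nn)//= ler_pdivrMr// mulrC.
  by rewrite sE; move: x1 l1; rewrite -/n ler_norml => *; apply/andP; split; lra.
move: l1; rewrite -/n; move: e1.
move: (rescaled_entropy R s) (harmonic_entropy) (I / _) (ln n) => u v e l.
move=> /andP[e0 e1] l1' ub d; rewrite subr_sqr normrM mulrC.
apply: ler_pM => //.
have -> : u + v = 2 * u - (u - v) by ring.
apply: le_trans (ler_normB _ _) _; rewrite normrM ger0_norm//.
lra.
Qed.

End Pointwise.

(** * Bridges and paths treated together *)

Section Family.
(** Bridges have b = 1 and d = 16 / 3 - z / 3, paths have b = 0 and d = 5 * z - 8, where z = pi^2 /
    6. The coefficient 4 * b in [mean2] is forced by [mean1]: the limiting variance d - 4 * b^2 must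
    contain no logarithm. *)
Variables (A : forall N, {set sign_seq N}) (b d K : R).
Arguments A : clear implicits.
Hypothesis AB : forall N s, s \in A N -> s \in dyck_bridges N.
Hypothesis A0 : forall N, (0 < #|A N|)%N.
Hypothesis b01 : 0 <= b <= 1.
Hypothesis K0 : 0 <= K.
Let rt (N : nat) : R := Num.sqrt N%:R.
Hypothesis mean1 : forall N, (0 < N)%N ->
  `|unif_mean (A N) (fun s => walk_sum hsum 0 s) - N%:R * (hsum N - 2 * b)| <=
  6 * (rt N * hsum N).
Hypothesis mean2 : forall N, (0 < N)%N ->
  `|unif_mean (A N) (fun s => walk_sum hsum 0 s ^+ 2) -
    N%:R ^+ 2 * (hsum N ^+ 2 - 4 * b * hsum N + d)| <=
  K * (N%:R * rt N * hsum N ^+ 2).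
Hypothesis mean_inv : forall N, (0 < N)%N ->
  unif_mean (A N) (fun s => walk_sum (fun h => h%:R^-1) 0 s) <= 6 * (rt N * hsum N).

Let ln_ge1 : \forall N \near \oo, (0 < N)%N /\ 1 <= ln N%:R :> R.
Proof.
near=> N; have e : expR 1 <= N%:R :> R by near: N; exact: nbhs_infty_ger.
have p : 0 < N%:R :> R by rewrite (lt_le_trans _ e)// expR_gt0.
by split; [rewrite -(ltr0n R)|rewrite -ler_expR lnK ?posrE].
Unshelve. all: by end_near. Qed.

Let scaled N : (0 < N)%N -> 1 <= ln N%:R :> R ->
  exists i : R, [/\ (rt N)^-1 = i, 0 < i <= 1, N%:R^-1 = i * i & N%:R * i = rt N].
Proof.
move=> N0 _; have s1 : 1 <= rt N by rewrite -sqrtr1 ler_sqrt// ?ler1n// ltr0n.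
have s0 : rt N != 0 by rewrite gt_eqF//; lra.
have e : N%:R = rt N * rt N :> R by rewrite -expr2 sqr_sqrtr.
exists (rt N)^-1; split => //.
- by rewrite invr_gt0 invf_le1 ?s1 ?andbT//; lra.
- by rewrite {1}e invfM.
- by rewrite {1}e mulfK.
Qed.

Let hsum_bound N : (0 < N)%N -> 1 <= ln N%:R :> R -> `|hsum N - ln N%:R - gamma| <= N%:R^-1.
Proof. by move=> N0 _; case/andP: (hsum_ln R N0) => h0 h1; rewrite ger0_norm. Qed.

(* mean1 and mean2 divided by the appropriate powers of N, with i = N^(-1/2),
   l = ln N, and h = hsum N = l + gamma + O(i). *)
Let normalized N : (0 < N)%N -> 1 <= ln N%:R :> R ->
  let u1 := unif_mean (A N) (fun s => walk_sum hsum 0 s) / N%:R in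
  let u2 := unif_mean (A N) (fun s => walk_sum hsum 0 s ^+ 2) / N%:R ^+ 2 in
  let v := unif_mean (A N) (fun s => walk_sum (fun h => h%:R^-1) 0 s) / N%:R in
  let l := ln N%:R in let i := (rt N)^-1 in
  exists h, [/\ `|h - l - gamma| <= i, 0 < i <= 1 /\ 1 <= h <= 3 * l,
    `|u1 - (h - 2 * b)| <= 6 * (h * i), `|u2 - (h ^+ 2 - 4 * b * h + d)| <= K * (h ^+ 2 * i)
    & v <= 6 * (h * i)].
Proof.
move=> N0 l1 /=; exists (hsum N).
have [i [-> i01 ni nri]] := scaled N0 l1.
have hb := hsum_bound N0 l1; rewrite ni in hb.
have n0 : 0 < N%:R :> R by rewrite ltr0n.
have i0 : 0 < i by case/andP: i01.
have hi : `|hsum N - ln N%:R - gamma| <= i.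
  by apply: le_trans hb _; rewrite ler_piMl ?(ltW i0)//; case/andP: i01.
split => //.
- split=> //; rewrite hsum_ge1//=; have := gamma_bound; move: hi i01 l1; rewrite ler_norml.
  by move=> /andP[? ?] /andP[? ?] ? /andP[? ?]; lra.
- rewrite -(ler_pM2l n0) -{1}[N%:R](ger0_norm (ltW n0)) -normrM.
  rewrite [X in `|X|](_ : _ = unif_mean (A N) (fun s => walk_sum hsum 0 s) -
    N%:R * (hsum N - 2 * b)); last by field; rewrite gt_eqF.
  by apply: le_trans (mean1 N0) _; rewrite -nri le_eqVlt; apply/orP; left; apply/eqP; ring.
- have n2 : 0 < N%:R ^+ 2 :> R by rewrite exprn_gt0.
  rewrite -(ler_pM2l n2) -{1}[N%:R ^+ 2](ger0_norm (ltW n2)) -normrM.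
  rewrite [X in `|X|](_ : _ = unif_mean (A N) (fun s => walk_sum hsum 0 s ^+ 2) -
    N%:R ^+ 2 * (hsum N ^+ 2 - 4 * b * hsum N + d)); last by field; rewrite gt_eqF.
  by apply: le_trans (mean2 N0) _; rewrite -nri le_eqVlt; apply/orP; left; apply/eqP; ring.
- rewrite ler_pdivrMr//; apply: le_trans (mean_inv N0) _.
  by rewrite -nri le_eqVlt; apply/orP; left; apply/eqP; ring.
Qed.

Let bigO_of_bound (f : nat -> R) c (g : nat -> R) (C : R) : 0 < C ->
  (forall N, (0 < N)%N -> 1 <= ln N%:R :> R -> `|f N - c| <= C * g N) ->
  f = cst c +O_\oo g.
Proof.
move=> C0 H; apply/eqaddOP/bigO_exP; exists C => //.
near=> N; have [N0 l1] : (0 < N)%N /\ 1 <= ln N%:R :> R by near: N; exact: ln_ge1.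
by apply: le_trans (H N N0 l1) _; rewrite ler_wpM2l ?(ltW C0)// ler_norm.
Unshelve. all: by end_near. Qed.

(** With l = ln N and h close to l + gamma, the main term (h - 2 * b) / 2 - gamma - l / 2 loses its
    logarithm and equals - gamma / 2 - b. *)
Lemma entropy_mean :
  (fun N => unif_mean (A N) (@rescaled_entropy R N)) =
  cst (- (gamma / 2 + b)) +O_\oo (fun N => ln N%:R / Num.sqrt N%:R).
Proof.
apply: (@bigO_of_bound _ _ _ 40) => // N N0 l1.
have D := unif_mean_dist (fun s sA => harmonic_entropy_dist N0 (AB sA)).
have n0 : N%:R != 0 :> R by rewrite pnatr_eq0 -lt0n.
have E : unif_mean (A N) (@harmonic_entropy N) =
    unif_mean (A N) (fun s => walk_sum hsum 0 s) / N%:R / 2 - (gamma + ln N%:R / 2).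
  rewrite (@eq_unif_mean _ _ _ _ (fun s => (2 * N%:R)^-1 * walk_sum hsum 0 s +
    - (gamma + ln N%:R / 2))) => [|s _]; last by rewrite /harmonic_entropy mulrC.
  move y1E : (unif_mean (A N) (fun s => walk_sum hsum 0 s)) => y1.
  transitivity ((2 * N%:R)^-1 * y1 + - (gamma + ln N%:R / 2)); last by field.
  by rewrite -y1E unif_meanD unif_meanZ (unif_mean_cst (A0 N)).
rewrite unif_meanZ E in D.
have := normalized N0 l1; move=> /= [h [hl [/andP[i0 i1] /andP[h1 h3]] e1 _ e3]].
rewrite [_^-1 * _](_ : _ = unif_mean (A N) (fun s => walk_sum (fun h => h%:R^-1) 0 s) / N%:R / 2)
  in D; last by field.
move: D e1 e3 hl i0 i1 l1 h1 h3; rewrite -/(rt N).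
move: (unif_mean _ _) (unif_mean _ _ / _) (unif_mean _ _ / _) ((rt N)^-1) (ln _).
move=> x v y i l D e1 e3 hl i0 i1 l1 h1 h3.
have hi : h * i <= 3 * l * i by rewrite ler_wpM2r// ltW.
have il : 1 * i <= l * i by rewrite ler_wpM2r// ltW.
move: D e1 hl; rewrite !ler_norml => /andP[? ?] /andP[? ?] /andP[? ?].
by apply/andP; split; lra.
Qed.

Lemma entropy_mean_sqr :
  (fun N => unif_mean (A N) (fun s => rescaled_entropy R s ^+ 2)) =
  cst (d / 4 + gamma ^+ 2 / 4 + b * gamma)
    +O_\oo (fun N => ln N%:R ^+ 2 / Num.sqrt N%:R).
Proof.
apply: (@bigO_of_bound _ _ _ (100 + 3 * K)) => [|N N0 l1].
  by rewrite ltr_wpDr// mulr_ge0.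
have D := unif_mean_dist (fun s sA => harmonic_entropy_sqr_dist N0 (AB sA) l1).
have n0 : N%:R != 0 :> R by rewrite pnatr_eq0 -lt0n.
pose m := gamma + ln N%:R / 2.
have E : unif_mean (A N) (fun s => harmonic_entropy s ^+ 2) =
    unif_mean (A N) (fun s => walk_sum hsum 0 s ^+ 2) / N%:R ^+ 2 / 4 -
    unif_mean (A N) (fun s => walk_sum hsum 0 s) / N%:R * m + m ^+ 2.
  rewrite (@eq_unif_mean _ _ _ _ (fun s => (4 * N%:R ^+ 2)^-1 * walk_sum hsum 0 s ^+ 2 +
    ((- m / N%:R) * walk_sum hsum 0 s + m ^+ 2))) => [|s _]; last first.
    by rewrite /harmonic_entropy -/m; field.
  move y1E : (unif_mean (A N) (fun s => walk_sum hsum 0 s)) => y1.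
  move y2E : (unif_mean (A N) (fun s => walk_sum hsum 0 s ^+ 2)) => y2.
  transitivity ((4 * N%:R ^+ 2)^-1 * y2 + ((- m / N%:R) * y1 + m ^+ 2)); last by field.
  by rewrite -y1E -y2E !unif_meanD !unif_meanZ (unif_mean_cst (A0 N)).
rewrite unif_meanZ E in D.
have := normalized N0 l1; move=> /= [h [hl [/andP[i0 i1] /andP[h1 h3]] e1 e2 e3]].
rewrite [_ * unif_mean _ _](_ : _ = 3 * ln N%:R *
  (unif_mean (A N) (fun s => walk_sum (fun h => h%:R^-1) 0 s) / N%:R)) in D; last by field.
move: D e1 e2 e3 hl i0 i1 l1 h1 h3 gamma_bound; rewrite -/(rt N) /m {E m n0}.
move: (unif_mean _ _) (unif_mean _ _ / _) (unif_mean _ _ / _) (unif_mean _ _ / _).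
move: ((rt N)^-1) (ln _) (gamma).
move=> i l g x v u1 u2 D e1 e2 e3 hl i0 i1 l1 h1 h3 /andP[g0 g1].
have li0 : 0 <= l * i by rewrite mulr_ge0 ?(ltW i0)//; lra.
have hi : h * i <= 3 * l * i by rewrite ler_wpM2r// ltW.
have l2 : 1 * (l * i) <= l * (l * i) by rewrite ler_wpM2r.
have l3 : 1 * i <= l * i by rewrite ler_wpM2r// ltW.
have m0 : 0 <= g + l / 2 by lra.
have m1 : g + l / 2 <= 2 * l by lra.
have a3 : l * v <= l * (18 * (l * i)) by apply: ler_wpM2l; lra.
have a2 : h ^+ 2 * i <= 9 * (l * (l * i)).
  rewrite [leRHS](_ : _ = (3 * l) * (3 * l) * i); last by ring.
  by rewrite expr2 ler_wpM2r ?(ltW i0)// ler_pM//; lra.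
have a2' : K * (h ^+ 2 * i) <= K * (9 * (l * (l * i))) by rewrite ler_wpM2l.
have a1 : `|(u1 - (h - 2 * b)) * (g + l / 2)| <= 36 * (l * (l * i)).
  rewrite normrM [`|g + _|]ger0_norm//.
  rewrite [leRHS](_ : _ = 18 * (l * i) * (2 * l)); last by ring.
  by apply: ler_pM => //; apply: le_trans e1 _; lra.
(* Since h / 2 - (g + l / 2) = (t - g) / 2, all powers of l cancel in the main term, and what
   depends on t is t^2 / 4 - t (2b + g) / 2 = O(i). *)
pose t := h - l - g.
have a4 : `|t * (2 * b + g)| <= i * 3.
  rewrite normrM; apply: ler_pM => //; rewrite ger0_norm; move: b01 => /andP[? ?]; lra.
have a5 : `|t * t| <= i * 1 by rewrite normrM; apply: ler_pM => //; apply: le_trans hl _.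
have tE : h = t + l + g by rewrite /t; ring.
have Kp : 0 <= K * (l * (l * i)) by rewrite !mulr_ge0//; lra.
rewrite [X in `|X|](_ : _ = (x - (u2 / 4 - u1 * (g + l / 2) + (g + l / 2) ^+ 2)) +
  (u2 - (h ^+ 2 - 4 * b * h + d)) / 4 - (u1 - (h - 2 * b)) * (g + l / 2) +
  (t * t / 4 - t * (2 * b + g) / 2)); last by rewrite tE; field.
rewrite [leRHS](_ : _ = 100 * (l * (l * i)) + 3 * (K * (l * (l * i)))); last by ring.
move: D e2 a1 a4 a5; rewrite !ler_norml.
move: (_ - _ : R) (u2 - _) (_ * (g + l / 2)) (t * t) (t * (2 * b + g)) => X1 X2 X3 X4 X5.
move=> /andP[? ?] /andP[? ?] /andP[? ?] /andP[? ?] /andP[? ?].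
by apply/andP; split; lra.
Qed.

End Family.
End EntropyAsymptotics.

Unset Implicit Arguments.

Theorem mainTheorem3 (R : realType) :
  [/\ (fun N : nat => unif_mean (dyck_bridges N) (@rescaled_entropy R N))
        = cst (- ((euler_gamma + 2) / 2))
          +O_\oo (fun N : nat => ln N%:R / Num.sqrt N%:R),
      (fun N : nat =>
         unif_mean (dyck_bridges N) (fun s => rescaled_entropy R s ^+ 2))
        = cst (4 / 3 + euler_gamma ^+ 2 / 4 + euler_gamma - pi ^+ 2 / 72)
          +O_\oo (fun N : nat => ln N%:R ^+ 2 / Num.sqrt N%:R),
      (fun N : nat => unif_mean (dyck_paths N) (@rescaled_entropy R N))
        = cst (- (euler_gamma / 2))
          +O_\oo (fun N : nat => ln N%:R / Num.sqrt N%:R)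
    & (fun N : nat =>
         unif_mean (dyck_paths N) (fun s => rescaled_entropy R s ^+ 2))
        = cst (euler_gamma ^+ 2 / 4 + 5 * pi ^+ 2 / 24 - 2)
          +O_\oo (fun N : nat => ln N%:R ^+ 2 / Num.sqrt N%:R)].
Proof.
pose z : R := pi ^+ 2 / 6.
have z03 : 0 <= z <= 3.
  have p4 : pi < 4 :> R by have := pihalf_lt2 R; lra.
  have p0 := pi_gt0 R; rewrite /z; move: p4 p0; move: (pi : R) => x x4 x0.
  by apply/andP; split; nra.
have hsum2z m : (0 < m)%N -> `|hsum2 R m - z| <= 5 / m%:R by exact: hsum2_pi.
have sh N : (0 < N)%N -> 0 <= Num.sqrt N%:R * hsum R N.
  by move=> _; rewrite mulr_ge0 ?sqrtr_ge0// hsum_ge0.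
(* The convention that the inverse of 0 is 0 makes 1/h an admissible weight for the exact moment
   formulas, which then also control the error term. *)
have inv0 : (fun h : nat => h%:R^-1 : R) 0%N = 0 by rewrite invr0.
have bridge_card N : (0 < #|dyck_bridges N|)%N.
  by rewrite -(ltr0n R) card_bridges walk_kernel_gt0.
have path_card N : (0 < #|dyck_paths N|)%N.
  by rewrite -(ltr0n R) card_paths divr_gt0 ?walk_kernel_gt0// natr1.
have bridge_inv N : (0 < N)%N -> unif_mean (dyck_bridges N)
    (fun s => walk_sum (fun h => h%:R^-1) 0 s) <= 6 * (Num.sqrt N%:R * hsum R N).
  move=> N0; rewrite (bridges_mean1 _ inv0).
  by apply: le_trans (bridge_level_inv R N) _; rewrite ler_wpM2r ?sh// ler_nat.
have path_inv N : (0 < N)%N -> unif_mean (dyck_paths N)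
    (fun s => walk_sum (fun h => h%:R^-1) 0 s) <= 6 * (Num.sqrt N%:R * hsum R N).
  move=> N0; rewrite (paths_mean1 _ inv0); apply: le_trans (excursion_level_inv R N0) _.
  by rewrite ler_wpM2l// ler_peMr ?sqrtr_ge0// hsum_ge1.
have bridge1 N : (0 < N)%N -> `|unif_mean (dyck_bridges N) (fun s => walk_sum (hsum R) 0 s) -
    N%:R * (hsum R N - 2 * 1)| <= 6 * (Num.sqrt N%:R * hsum R N).
  move=> N0; rewrite (bridges_mean1 _ (hsum_0 R)) (_ : N%:R * _ = N%:R * hsum R N - 2 * N%:R).
    exact: bridge_mean1.
  by ring.
have path1 N : (0 < N)%N -> `|unif_mean (dyck_paths N) (fun s => walk_sum (hsum R) 0 s) -
    N%:R * (hsum R N - 2 * 0)| <= 6 * (Num.sqrt N%:R * hsum R N).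
  move=> N0; rewrite (paths_mean1 _ (hsum_0 R)) excursion_mean1.
  rewrite (_ : _ - _ = 1 * hsum R N); last by ring.
  rewrite ger0_norm ?mul1r ?hsum_ge0// -[leLHS]mul1r mulrA ler_wpM2r ?hsum_ge0//.
  have : 1 <= Num.sqrt N%:R :> R by rewrite -[X in X <= _]sqrtr1 ler_sqrt// ler1n.
  by move: (Num.sqrt _) => x; lra.
have bridge2 N : (0 < N)%N -> `|unif_mean (dyck_bridges N) (fun s => walk_sum (hsum R) 0 s ^+ 2) -
    N%:R ^+ 2 * (hsum R N ^+ 2 - 4 * 1 * hsum R N + (16 / 3 - z / 3))| <=
    800 * (N%:R * Num.sqrt N%:R * hsum R N ^+ 2).
  move=> N0; rewrite (bridges_mean2 _ (hsum_0 R)) mulr1 addrA; exact: bridge_mean2.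
have path2 N : (0 < N)%N -> `|unif_mean (dyck_paths N) (fun s => walk_sum (hsum R) 0 s ^+ 2) -
    N%:R ^+ 2 * (hsum R N ^+ 2 - 4 * 0 * hsum R N + (5 * z - 8))| <=
    300 * (N%:R * Num.sqrt N%:R * hsum R N ^+ 2).
  move=> N0; rewrite (paths_mean2 _ (hsum_0 R)) mulr0 mul0r subr0 addrA.
  exact: excursion_mean2.
have subB N s : s \in dyck_bridges N -> s \in dyck_bridges N by [].
have subP N s : s \in dyck_paths N -> s \in dyck_bridges N by rewrite inE => /andP[].
have b1 : 0 <= (1 : R) <= 1 by rewrite ler01 lexx.
have b0 : 0 <= (0 : R) <= 1 by rewrite ler01 lexx.
split.
- rewrite (_ : (euler_gamma + 2) / 2 = euler_gamma / 2 + 1); last by field.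
  exact: (entropy_mean subB bridge_card bridge1 bridge2 bridge_inv).
- rewrite (_ : 4 / 3 + _ + _ - _ =
    (16 / 3 - z / 3) / 4 + euler_gamma ^+ 2 / 4 + 1 * euler_gamma); last first.
    by rewrite /z; move: (pi : R) (euler_gamma : R) => x y; field.
  exact: (entropy_mean_sqr subB bridge_card b1 (ler0n R 800) bridge1 bridge2 bridge_inv).
- rewrite -[euler_gamma / 2]addr0.
  exact: (entropy_mean subP path_card path1 path2 path_inv).
- rewrite (_ : _ + _ - 2 =
    (5 * z - 8) / 4 + euler_gamma ^+ 2 / 4 + 0 * euler_gamma); last first.
    by rewrite /z; move: (pi : R) (euler_gamma : R) => x y; field.
  exact: (entropy_mean_sqr subP path_card b0 (ler0n R 300) path1 path2 path_inv).
Qed.
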